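(* Assume $\lambda^*/n\to0$, $\lambda^*\to\infty$, and that the limits $\lambda_j/\lambda^*\to\lambda^0_j\in[0,1]$ and $\sqrt{\lambda^*}/\lambda_j\to\psi_j\in[0,\infty]$ exist for all $j$. Then every open set $\mathcal{O}\subseteq\mathbb{R}^p$ with $\mathcal{M}\subseteq\mathcal{O}$ satisfies $$\lim_{n\to\infty}\inf_{\beta\in\mathbb{R}^p}P_\beta\Big(\beta\in\hat\beta_{AL}-\sqrt{\tfrac{\lambda^*}{n}}\,\mathcal{O}\Big)=1.$$ Moreover, for $d>0$ let $\mathcal{M}_d=\mathcal{M}(d\lambda^0,\psi)$. Then for every $0<d<1$, $$\lim_{n\to\infty}\inf_{\beta\in\mathbb{R}^p}P_\beta\Big(\beta\in\hat\beta_{AL}-\sqrt{\tfrac{\lambda^*}{n}}\,\mathcal{M}_d\Big)=0.$$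
   Context: For each $n\ge p$: linear regression model $y=X\beta+\varepsilon$ with $y\in\mathbb{R}^n$, non-stochastic $X\in\mathbb{R}^{n\times p}$ ($p$ fixed) of full column rank, unknown $\beta\in\mathbb{R}^p$, and $\varepsilon$ with i.i.d. components of mean zero and finite variance $\sigma^2>0$; $P_\beta$ is the probability when the true parameter is $\beta$. $X'X/n\to C$ positive definite, and $\sqrt{n}(X'X)^{-1}X'\varepsilon\overset{d}{\longrightarrow}N(0,\sigma^2C^{-1})$. $\hat\beta_{LS}=(X'X)^{-1}X'y$; the events $\{\hat\beta_{LS,j}=0\}$ have probability zero and are excluded. Non-negative tuning parameters $\lambda_j=\lambda_{n,j}$ (each either positive for all large $n$ or zero for all large $n$), $\lambda^*=\max_j\lambda_j$, convention $\sqrt{\lambda^*}/0=\infty$. Adaptive Lasso: $\hat\beta_{AL}=\arg\min_{b\in\mathbb{R}^p}\big(\|y-Xb\|^2+2\sum_{j=1}^p\lambda_j|b_j|/|\hat\beta_{LS,j}|\big)$. For $\mu\in[0,\infty)^p$ and $\psi\in[0,\infty]^p$, $\mathcal{M}(\mu,\psi)=\{m\in\mathbb{R}^p:(Cm)_j=0\text{ if }\psi_j=\infty,\ m_j(Cm)_j\le\mu_j\text{ if }\psi_j<\infty\}$, and $\mathcal{M}=\mathcal{M}(\lambda^0,\psi)$. For a set $S$ and scalar $c$, $\hat\beta_{AL}-cS=\{\hat\beta_{AL}-cs:s\in S\}$. *)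

(* Defs.v *)
From HB Require Import structures.
From mathcomp Require Import all_boot all_order all_algebra.
From mathcomp Require Import all_classical all_reals all_analysis.
Import Order.TTheory GRing.Theory Num.Theory numFieldNormedType.Exports.

Set Implicit Arguments.
Unset Strict Implicit.
Unset Printing Implicit Defensive.

Local Open Scope classical_set_scope.
Local Open Scope ring_scope.

Definition sqnorm (R : realType) (n : nat) (v : 'cV[R]_n) : R :=
  \sum_(i < n) (v i 0) ^+ 2.

Definition LSest (R : realType) (n p : nat) (X : 'M[R]_(n, p)) (y : 'cV[R]_n)
  : 'cV[R]_p := invmx (X^T *m X) *m (X^T *m y).

Definition AL_obj (R : realType) (n p : nat) (X : 'M[R]_(n, p))
  (lam : 'I_p -> R) (y : 'cV[R]_n) (b : 'cV[R]_p) : R :=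
  sqnorm (y - X *m b)
  + 2 * \sum_(j < p) lam j * `|b j 0| / `|LSest X y j 0|.

Definition is_AL (R : realType) (n p : nat) (X : 'M[R]_(n, p))
  (lam : 'I_p -> R) (y : 'cV[R]_n) (b : 'cV[R]_p) : Prop :=
  forall b' : 'cV[R]_p, AL_obj X lam y b <= AL_obj X lam y b'.

Definition epsvec (R : realType) (T : Type) (n : nat) (eps : 'I_n -> T -> R)
  (w : T) : 'cV[R]_n := \col_i eps i w.

Definition Mset (R : realType) (p : nat) (C : 'M[R]_p) (mu : 'I_p -> R)
  (psi : 'I_p -> \bar R) : set 'cV[R]_p :=
  [set m | forall j : 'I_p,
     (psi j = +oo%E -> (C *m m) j 0 = 0) /\
     ((psi j < +oo)%E -> m j 0 * (C *m m) j 0 <= mu j)].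

(* event { beta \in betaAL - c S } under P_beta, i.e. when y = X beta + eps *)
Definition cover_event (R : realType) (T : Type) (n p : nat)
  (X : 'M[R]_(n, p)) (lam : 'I_p -> R) (eps : 'I_n -> T -> R)
  (beta : 'cV[R]_p) (c : R) (S : set 'cV[R]_p) : set T :=
  [set w | exists b : 'cV[R]_p,
     is_AL X lam (X *m beta + epsvec eps w) b /\
     exists s : 'cV[R]_p, S s /\ beta = b - c *: s].

Definition lamstar (R : realType) (p : nat) (lam : 'I_p -> R) : R :=
  \big[Num.max/0]_(j < p) lam j.

Definition psi_ratio (R : realType) (p : nat) (lam : 'I_p -> R) (j : 'I_p)
  : \bar R :=
  if lam j == 0 then +oo%E else (Num.sqrt (lamstar lam) / lam j)%:E.

Definition iid_family (d : measure_display) (T : measurableType d)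
  (R : realType) (P : probability T R) (n : nat) (f : 'I_n -> T -> R) : Prop :=
  [/\ (forall i, measurable_fun setT (f i)),
      (forall i j (A : set R), measurable A ->
         P (f i @^-1` A) = P (f j @^-1` A)) &
      (forall (J : {set 'I_n}) (A : 'I_n -> set R),
         (forall i, measurable (A i)) ->
         P (\bigcap_(i in [set i | i \in J]) (f i @^-1` A i)) =
         (\prod_(i in J) P (f i @^-1` A i))%E)].

Definition inf_cover (d : measure_display) (T : measurableType d)
  (R : realType) (P : probability T R) (n p : nat) (X : 'M[R]_(n, p))
  (lam : 'I_p -> R) (eps : 'I_n -> T -> R) (c : R) (S : set 'cV[R]_p)
  : \bar R :=
  ereal_inf [set P (cover_event X lam eps beta c S) | beta in [set: 'cV[R]_p]].

(* Main.v *)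
(* Put D = X'X/n, W = sqrt(n)(X'X)^{-1}X'eps, L = lambda^*, r = sqrt(n/L), and
   rescale: ell = r beta_LS, v = r (beta_AL - beta_LS), u = r (beta_AL - beta).
   Then u = v + W / sqrt L, and W / sqrt L -> 0 in probability.  As long as no
   ell_j vanishes, the subgradient conditions give, for every beta,
     v_j (D v)_j <= lambda_j / L   and   |(D v)_j| |ell_j| <= lambda_j / L.
   The first bound keeps v bounded and yields the inequalities defining M.  The
   second one yields (C m)_j = 0 when psi_j = oo, since lambda_j / sqrt L
   -> 0 and |sqrt(n) beta_LS,j| >= eta with high probability uniformly in beta,
   because the limit law of W_j has no atom.  A compactness argument then puts u
   in any open set containing M.
   For the second claim choose j with lambda^0_j = 1, let the other coordinates
   of beta tend to infinity on the scale 1/r, and let r beta_j be slightly larger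
   than sqrt((C^{-1})_jj): then u_j (C u)_j stays above d.
   Tightness and the anti-concentration of W_j are read off the characteristic
   functions: the former by integrating 1 - cos(s W_j) over s in [0, u], the
   latter by a Fejer kernel. *)

Require Import Defs.
From HB Require Import structures.
From mathcomp Require Import all_boot all_order all_algebra.
From mathcomp Require Import all_classical all_reals all_analysis.
From mathcomp Require Import measurable_realfun ring lra.
Import Order.TTheory GRing.Theory Num.Theory numFieldNormedType.Exports.

Set Implicit Arguments.
Unset Strict Implicit.
Unset Printing Implicit Defensive.

Local Open Scope classical_set_scope.
Local Open Scope ring_scope.

(** * Quadratic forms and compactness *)

Lemma continuous_sumr (R : realType) (T : topologicalType) (I : Type)
    (r : seq I) (F : I -> T -> R) :
  (forall i, continuous (F i)) -> continuous (fun x => \sum_(i <- r) F i x).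
Proof.
move=> cF; elim: r => [|i r ih].
  rewrite (_ : (fun x => _) = cst 0); first exact: cst_continuous.
  by apply/funext => x; rewrite big_nil.
rewrite (_ : (fun x => _) = (fun x => F i x + \sum_(j <- r) F j x)).
  by move=> x; apply: continuousD; [exact: cF | exact: ih].
by apply/funext => x; rewrite big_cons.
Qed.

Lemma mulmx_coord_continuous (R : realType) (m p : nat) (A : 'M[R]_(m, p)) i :
  continuous (fun v : 'cV[R]_p => (A *m v) i 0).
Proof.
rewrite (_ : (fun v => _) = fun v : 'cV[R]_p => \sum_k A i k * v k 0).
  apply: continuous_sumr => k v; apply: continuousM.
    exact: cst_continuous.
  exact: coord_continuous.
by apply/funext => v; rewrite mxE.
Qed.

(** Transposition is continuous and carries the compact box of row vectors onto this one. *)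
Lemma cV_box_compact (R : realType) (p : nat) (B : R) :
  compact [set v : 'cV[R]_p | forall j, `|v j 0| <= B].
Proof.
have tr_cont : continuous (fun v : 'rV[R]_p => v^T).
  move=> v s /nbhs_ballP[e e0 es]; apply/nbhs_ballP; exists e => // w [_ vw].
  by apply: es; split=> // i j; rewrite !mxE.
have := @rV_compact _ p (fun=> `[- B, B]%classic)
  (fun=> @segment_compact _ (- B) B).
move=> /(continuous_compact (continuous_subspaceT tr_cont)).
congr compact; apply/seteqP; split=> v /=.
  by case=> u uB <- j; have := uB j; rewrite mxE in_itv /= ler_norml.
move=> vB; exists v^T; last by rewrite trmxK.
by move=> j; rewrite mxE in_itv /= -ler_norml.
Qed.

Lemma sqnorm_ge0 (R : realType) (p : nat) (v : 'cV[R]_p) : 0 <= sqnorm v.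
Proof. by apply: sumr_ge0 => i _; exact: sqr_ge0. Qed.

Lemma sqnorm_continuous (R : realType) (p : nat) :
  continuous (@sqnorm R p).
Proof.
apply: continuous_sumr => i v.
apply: (@continuous_comp _ _ _ (fun v : 'cV[R]_p => v i 0) (fun x => x ^+ 2)).
  exact: coord_continuous.
exact: exprn_continuous.
Qed.

Lemma sqr_coord_le_sqnorm (R : realType) (p : nat) (v : 'cV[R]_p) j :
  v j 0 ^+ 2 <= sqnorm v.
Proof.
by rewrite /sqnorm (bigD1 j) //= lerDl; apply: sumr_ge0 => i _; exact: sqr_ge0.
Qed.

Lemma sqnormZ (R : realType) (p : nat) (a : R) (v : 'cV[R]_p) :
  sqnorm (a *: v) = a ^+ 2 * sqnorm v.
Proof.
by rewrite /sqnorm mulr_sumr; apply: eq_bigr => i _; rewrite mxE exprMn.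
Qed.

Lemma sqnormE (R : realType) (p : nat) (v : 'cV[R]_p) :
  sqnorm v = (v^T *m v) 0 0.
Proof. by rewrite mxE; apply: eq_bigr => i _; rewrite mxE expr2. Qed.

Lemma sqnorm_gt0 (R : realType) (p : nat) (v : 'cV[R]_p) :
  v != 0 -> 0 < sqnorm v.
Proof.
move=> v0; rewrite lt_neqAle sqnorm_ge0 andbT eq_sym; apply: contra v0.
move=> /eqP s0; apply/eqP/colP => j; rewrite mxE.
by have := sqr_coord_le_sqnorm v j; rewrite s0 => h; apply/eqP;
   rewrite -sqrf_eq0 eq_le h sqr_ge0.
Qed.

Lemma qformE (R : realType) (p : nat) (A : 'M[R]_p) (v : 'cV[R]_p) :
  (v^T *m A *m v) 0 0 = \sum_j v j 0 * (A *m v) j 0.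
Proof. by rewrite -mulmxA mxE; apply: eq_bigr => j _; rewrite mxE. Qed.

Lemma qformZ (R : realType) (p : nat) (A : 'M[R]_p) (a : R) (v : 'cV[R]_p) :
  ((a *: v)^T *m A *m (a *: v)) 0 0 = a ^+ 2 * (v^T *m A *m v) 0 0.
Proof.
rewrite !qformE mulr_sumr; apply: eq_bigr => j _.
by rewrite -scalemxAr !mxE; ring.
Qed.

Lemma qform_continuous (R : realType) (p : nat) (A : 'M[R]_p) :
  continuous (fun v : 'cV[R]_p => (v^T *m A *m v) 0 0).
Proof.
under eq_fun do rewrite qformE.
apply: continuous_sumr => j v; apply: continuousM.
  exact: coord_continuous.
exact: mulmx_coord_continuous.
Qed.

(** The form attains a minimum on the compact unit sphere, positive by definiteness; homogeneity of
    degree two extends the bound to all vectors. *)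
Lemma qform_lower_bound (R : realType) (p : nat) (A : 'M[R]_p) :
  (forall v : 'cV[R]_p, v != 0 -> 0 < (v^T *m A *m v) 0 0) ->
  exists2 k : R, 0 < k & forall v, k * sqnorm v <= (v^T *m A *m v) 0 0.
Proof.
move=> Apd.
pose K := [set v : 'cV[R]_p | forall j, `|v j 0| <= 1] `&`
          (@sqnorm R p @^-1` [set 1]).
have Kc : compact K.
  apply: (subclosed_compact _ (@cV_box_compact R p 1)); last by move=> v [].
  apply: closedI.
    by apply: compact_closed (@cV_box_compact R p 1); exact: norm_hausdorff.
  apply: closed_comp; first by move=> x _; exact: sqnorm_continuous.
  exact: closed_eq.
have Kn (v : 'cV[R]_p) : v != 0 -> K ((Num.sqrt (sqnorm v))^-1 *: v).
  move=> v0; have s0 := sqnorm_gt0 v0; split => /=.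
    move=> j; rewrite mxE normrM ger0_norm ?invr_ge0 ?sqrtr_ge0 //.
    rewrite mulrC ler_pdivrMr ?sqrtr_gt0 // mul1r -sqrtr_sqr.
    by rewrite ler_wsqrtr // sqr_coord_le_sqnorm.
  by rewrite sqnormZ exprVn sqr_sqrtr ?ltW // mulVf ?gt_eqF.
(* An empty sphere means that there is no nonzero vector ([p = 0]), so any constant works. *)
have [K0|/set0P/negP] := pselect (K !=set0); last first.
  rewrite negbK => /eqP K0; exists 1 => // v.
  have [->|v0] := eqVneq v 0.
    by rewrite qformE mul1r; apply: ler_sum => i _; rewrite !mxE mul0r expr0n.
  by have := Kn _ v0; rewrite K0.
have [c /set_mem cK cmin] := compact_EVT_min K0 Kc
  (continuous_subspaceT (@qform_continuous _ _ A)).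
have c0 : c != 0.
  apply/eqP => c0; case: cK => _ /=; rewrite c0 /sqnorm big1.
    by move/eqP; rewrite eq_sym oner_eq0.
  by move=> i _; rewrite mxE expr0n.
exists ((c^T *m A *m c) 0 0); first exact: Apd.
move=> v; have [->|v0] := eqVneq v 0.
  rewrite [X in _ * X]big1 ?mulr0 ?mulmx0 ?mxE // => i _.
  by rewrite mxE expr0n.
have s0 := sqnorm_gt0 v0.
have := cmin _ (mem_set (Kn _ v0)).
rewrite qformZ exprVn sqr_sqrtr ?sqnorm_ge0 //.
by rewrite [X in _ <= X]mulrC ler_pdivlMr.
Qed.

Lemma cvg_mx_coord_near (R : realType) (m n : nat) (A : nat -> 'M[R]_(m, n))
    (B : 'M[R]_(m, n)) (e : R) :
  A @ \oo --> B -> 0 < e ->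
  \forall k \near \oo, forall i j, `|A k i j - B i j| < e.
Proof.
move=> /cvg_ballP AB e0; have := AB _ e0; apply: filterS => k [_ h] i j.
by rewrite distrC; have := h i j; rewrite -ball_normE.
Qed.

Lemma mulmx_perturb (R : realType) (m p : nat) (A B : 'M[R]_(m, p))
    (v : 'cV[R]_p) (e b : R) i :
  (forall i j, `|A i j - B i j| <= e) -> (forall j, `|v j 0| <= b) ->
  `|(A *m v) i 0 - (B *m v) i 0| <= p%:R * (e * b).
Proof.
move=> AB vb; have -> : (A *m v) i 0 - (B *m v) i 0 =
    \sum_j (A i j - B i j) * v j 0.
  by rewrite !mxE -sumrB; apply: eq_bigr => j _; rewrite mulrBl.
apply: (le_trans (ler_norm_sum _ _ _)).
apply: (@le_trans _ _ (\sum_(j < p) e * b)).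
  by apply: ler_sum => j _; rewrite normrM ler_pM.
by rewrite sumr_const card_ord mulr_natl.
Qed.

(** Comes from [2 |v_i v_j| <= v_i^2 + v_j^2], summed over all pairs. *)
Lemma qform_perturb (R : realType) (p : nat) (A B : 'M[R]_p) (v : 'cV[R]_p)
    (e : R) :
  (forall i j, `|A i j - B i j| <= e) ->
  `|(v^T *m A *m v) 0 0 - (v^T *m B *m v) 0 0| <= e * (p%:R * sqnorm v).
Proof.
move=> AB; rewrite !qformE -sumrB.
have -> : \sum_(i < p) (v i 0 * (A *m v) i 0 - v i 0 * (B *m v) i 0) =
    \sum_(i < p) \sum_(j < p) (A i j - B i j) * (v i 0 * v j 0).
  apply: eq_bigr => i _; rewrite !mxE !mulr_sumr -sumrB.
  by apply: eq_bigr => j _; ring.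
apply: (le_trans (ler_norm_sum _ _ _)).
apply: (@le_trans _ _ (\sum_(i < p) \sum_(j < p)
   e * ((v i 0 ^+ 2 + v j 0 ^+ 2) / 2))).
  apply: ler_sum => i _; apply: (le_trans (ler_norm_sum _ _ _)).
  apply: ler_sum => j _; rewrite normrM ler_pM // normrM.
  rewrite -[v i 0 ^+ 2]real_normK ?num_real // -[v j 0 ^+ 2]real_normK ?num_real //.
  have := sqr_ge0 (`|v i 0| - `|v j 0|); nra.
have -> : \sum_(i < p) \sum_(j < p) e * ((v i 0 ^+ 2 + v j 0 ^+ 2) / 2) =
    e * (p%:R * sqnorm v).
  have inner (i : 'I_p) : \sum_(j < p) e * ((v i 0 ^+ 2 + v j 0 ^+ 2) / 2) =
      p%:R * (e / 2) * v i 0 ^+ 2 + e / 2 * sqnorm v.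
    rewrite (eq_bigr (fun j => e / 2 * v i 0 ^+ 2 + e / 2 * v j 0 ^+ 2)).
      rewrite big_split /= sumr_const card_ord -mulr_sumr -/(sqnorm v).
      by rewrite -[_ *+ p]mulr_natl; ring.
    by move=> j _; ring.
  rewrite (eq_bigr _ (fun i _ => inner i)) big_split /= -mulr_sumr.
  by rewrite sumr_const card_ord -/(sqnorm v) -[_ *+ p]mulr_natl; field.
by [].
Qed.

(** An entrywise error of [k / (2 * p.+1%:R)] moves the form by at most [k / 2 * sqnorm v], so half
    of the constant of [C] survives; [p.+1] keeps the denominator positive. *)
Lemma qform_lower_bound_near (R : realType) (p : nat) (D : nat -> 'M[R]_p)
    (C : 'M[R]_p) :
  D @ \oo --> C ->
  (forall v : 'cV[R]_p, v != 0 -> 0 < (v^T *m C *m v) 0 0) ->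
  exists2 k : R, 0 < k & \forall n \near \oo,
    forall v, k * sqnorm v <= (v^T *m D n *m v) 0 0.
Proof.
move=> DC /qform_lower_bound[k k0 kC]; exists (k / 2); first by rewrite divr_gt0.
have e0 : 0 < k / (2 * p.+1%:R) by rewrite divr_gt0 // mulr_gt0.
have := cvg_mx_coord_near DC e0; apply: filterS => n Dn v.
have := @qform_perturb _ _ (D n) C v _ (fun i j => ltW (Dn i j)).
move=> /ler_normlP[h _]; have kv := kC v; have s0 := sqnorm_ge0 v.
have hp : k / (2 * p.+1%:R) * (p%:R * sqnorm v) <= k / 2 * sqnorm v.
  rewrite invfM !mulrA ler_wpM2r // -mulrA ler_piMr //.
    by rewrite divr_ge0 // ltW.
  by rewrite ler_pdivrMl ?mulr1 ?ler_nat.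
have := le_trans h hp; lra.
Qed.

Lemma qform_unitmx (R : realType) (p : nat) (A : 'M[R]_p) (k : R) :
  0 < k -> (forall v : 'cV[R]_p, k * sqnorm v <= (v^T *m A *m v) 0 0) ->
  A \in unitmx.
Proof.
move=> k0 kA; rewrite unitmxE unitfE; apply/negP => /det0P[v v0 vA].
have vt0 : v^T != 0 by rewrite trmx_eq0.
have := kA v^T; rewrite trmxK vA mul0mx mxE leNgt mulr_gt0 //.
exact: sqnorm_gt0.
Qed.

(** * Penalized least squares *)

Lemma sqnormB (R : realType) (n : nat) (a b : 'cV[R]_n) :
  sqnorm (a - b) = sqnorm a - 2 * (b^T *m a) 0 0 + sqnorm b.
Proof.
rewrite !mxE mulr_sumr -sumrB -big_split; apply: eq_bigr => i _.
by rewrite /= !mxE; ring.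
Qed.

(** Lets [t] tend to 0; this turns comparisons of objective values under small moves into
    first-order conditions. *)
Lemma le_of_le_addM (R : realType) (a b c : R) :
  (forall t, 0 < t <= 1 -> a <= b + t * c) -> a <= b.
Proof.
move=> h; apply/ler_addgt0Pr => e e0.
have c1 : 0 < `|c| + 1 by rewrite ltr_wpDl.
have t0 : 0 < Num.min 1 (e / (`|c| + 1)) by rewrite lt_min ltr01 divr_gt0.
apply: (le_trans (h (Num.min 1 (e / (`|c| + 1))) _)).
  by rewrite t0 ge_min lexx.
rewrite lerD2l (@le_trans _ _ (e / (`|c| + 1) * `|c|)) //.
  rewrite (@le_trans _ _ (Num.min 1 (e / (`|c| + 1)) * `|c|)) //.
    by rewrite ler_pM2l // ler_norm.
  by rewrite ler_wpM2r // ge_min lexx orbT.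
by rewrite -mulrA ger_pMr // ler_pdivrMl // mulr1 lerDl.
Qed.

(** For a fixed response the adaptive weights are constants, so the adaptive Lasso is a Lasso with
    these weights. A zero component of [LSest] gives weight 0, since division by 0 returns 0. *)
Definition pen_obj (R : realType) (n p : nat) (X : 'M[R]_(n, p))
    (wt : 'I_p -> R) (y : 'cV[R]_n) (b : 'cV[R]_p) : R :=
  sqnorm (y - X *m b) + 2 * \sum_j wt j * `|b j 0|.

Lemma AL_objE (R : realType) (n p : nat) (X : 'M[R]_(n, p)) (lam : 'I_p -> R)
    (y : 'cV[R]_n) (b : 'cV[R]_p) :
  AL_obj X lam y b = pen_obj X (fun j => lam j / `|LSest X y j 0|) y b.
Proof.
by congr (_ + 2 * _); apply: eq_bigr => j _; rewrite mulrAC.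
Qed.

Lemma is_AL_pen_obj (R : realType) (n p : nat) (X : 'M[R]_(n, p))
    (lam : 'I_p -> R) (y : 'cV[R]_n) (b : 'cV[R]_p) :
  is_AL X lam y b ->
  let f := pen_obj X (fun j => lam j / `|LSest X y j 0|) y in
  forall b', f b <= f b'.
Proof. by move=> bmin f b'; rewrite /f -!AL_objE. Qed.

Section penalized_least_squares.
Variables (R : realType) (n p : nat) (X : 'M[R]_(n, p)) (wt : 'I_p -> R).
Variable y : 'cV[R]_n.
Hypothesis wt_ge0 : forall j, 0 <= wt j.

Local Notation f := (pen_obj X wt y).

Lemma pen_obj_coord_shift (b : 'cV[R]_p) j (t : R) :
  f (b + t *: delta_mx j 0) =
  f b - 2 * t * (X^T *m (y - X *m b)) j 0
    + t ^+ 2 * sqnorm (X *m delta_mx j (0 : 'I_1))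
    + 2 * wt j * (`|b j 0 + t| - `|b j 0|).
Proof.
rewrite /pen_obj mulmxDr opprD addrA sqnormB trmx_mul -mulmxA.
rewrite -scalemxAr sqnormZ.
have -> : ((t *: delta_mx j (0 : 'I_1))^T *m (X^T *m (y - X *m b))) 0 0 =
    t * (X^T *m (y - X *m b)) j 0.
  move: (X^T *m _) => u.
  rewrite [LHS]mxE (bigD1 j) //= big1 ?addr0; last first.
    by move=> i /negbTE ij; rewrite !mxE ij mulr0 mul0r.
  by rewrite !mxE !eqxx mulr1.
have -> : \sum_i wt i * `|(b + t *: delta_mx j 0) i 0| =
    \sum_i wt i * `|b i 0| + wt j * (`|b j 0 + t| - `|b j 0|).
  rewrite (bigD1 j) //= [in RHS](bigD1 j) //= !mxE !eqxx mulr1.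
  rewrite (eq_bigr (fun i => wt i * `|b i 0|)); first by ring.
  by move=> i /negbTE ij; rewrite !mxE ij mulr0 addr0.
ring.
Qed.

(** Moving one coordinate by [t] and by [- t] bounds the gradient [r]; shrinking [b j 0] towards 0
    gives complementary slackness. *)
Lemma pen_obj_kkt (b : 'cV[R]_p) j :
  (forall b', f b <= f b') ->
  let r := (X^T *m (y - X *m b)) j 0 in
  `|r| <= wt j /\ r * b j 0 = wt j * `|b j 0|.
Proof.
move=> bmin r; set g := sqnorm (X *m delta_mx j (0 : 'I_1)).
have key t : 0 <= - (2 * t * r) + t ^+ 2 * g
                 + 2 * wt j * (`|b j 0 + t| - `|b j 0|).
  by have := bmin (b + t *: delta_mx j 0); rewrite pen_obj_coord_shift
    -/r -/g; lra.
have dist t : wt j * (`|b j 0 + t| - `|b j 0|) <= wt j * `|t|.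
  by rewrite ler_wpM2l // lerBlDl ler_normD.
have rw : `|r| <= wt j.
  apply/ler_normlP; split; apply: (@le_of_le_addM _ _ _ (g / 2)) => t /andP[t0 _].
    have := key (- t); have := dist (- t); rewrite normrN (gtr0_norm t0).
    move=> h1 h2; rewrite -(ler_pM2l t0); lra.
  have := key t; have := dist t; rewrite (gtr0_norm t0).
  move=> h1 h2; rewrite -(ler_pM2l t0); lra.
split=> //; apply/eqP; rewrite eq_le; apply/andP; split.
  by rewrite (le_trans (ler_norm _)) // normrM ler_wpM2r.
(* Scaling the coordinate by [1 - t] lowers its penalty by exactly the fraction [t], which yields
   the reverse inequality. *)
apply: (@le_of_le_addM _ _ _ (b j 0 ^+ 2 * g / 2)) => t /andP[t0 t1].
have := key (- (t * b j 0)).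
have -> : `|b j 0 + - (t * b j 0)| = (1 - t) * `|b j 0|.
  rewrite -[X in X - _]mul1r -mulrBl normrM ger0_norm //; lra.
by move=> h; rewrite -(ler_pM2l t0); lra.
Qed.

Lemma sqnorm_midpoint (b c : 'cV[R]_p) :
  sqnorm (y - X *m (2^-1 *: (b + c))) =
  (sqnorm (y - X *m b) + sqnorm (y - X *m c)) / 2
    - sqnorm (X *m (b - c)) / 4.
Proof.
rewrite -big_split /= !mulr_suml -sumrB; apply: eq_bigr => i _.
rewrite -scalemxAr mulmxDr mulmxBr.
move: (X *m b) (X *m c) => Xb Xc; rewrite !mxE; by field.
Qed.

(** Compare [bs] with the midpoint: the parallelogram law gains a quarter of
    [sqnorm (X *m (b - bs))], doubled when the average is cleared. *)
Lemma pen_obj_strong_convex (b bs : 'cV[R]_p) :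
  (forall b', f bs <= f b') -> f bs + sqnorm (X *m (b - bs)) / 2 <= f b.
Proof.
move=> /(_ (2^-1 *: (b + bs))); rewrite {2}/pen_obj sqnorm_midpoint => h.
have : \sum_j wt j * `|(2^-1 *: (b + bs)) j 0| <=
    (\sum_j wt j * `|b j 0| + \sum_j wt j * `|bs j 0|) / 2.
  rewrite -big_split /= mulr_suml; apply: ler_sum => j _.
  rewrite !mxE normrM ger0_norm ?invr_ge0 //.
  have := ler_wpM2l (wt_ge0 j) (ler_normD (b j 0) (bs j 0)); lra.
by move: h; rewrite /pen_obj; lra.
Qed.

Lemma pen_obj_continuous : continuous f.
Proof.
have fit : continuous (fun b : 'cV[R]_p => sqnorm (y - X *m b)).
  apply: continuous_sumr => i v.
  apply: (@continuous_comp _ _ _ (fun v : 'cV[R]_p => (y - X *m v) i 0)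
    (fun x => x ^+ 2)); last exact: exprn_continuous.
  rewrite (_ : (fun _ => _) = (fun v : 'cV[R]_p => y i 0 - (X *m v) i 0)).
    by apply: continuousB; [exact: cst_continuous|exact: mulmx_coord_continuous].
  by apply/funext => u; rewrite [LHS]mxE [X in _ + X]mxE.
have pen : continuous (fun b : 'cV[R]_p => \sum_j wt j * `|b j 0|).
  apply: continuous_sumr => j v.
  apply: (@continuousM R _ (fun=> wt j) (fun v : 'cV[R]_p => `|v j 0|)).
    exact: cst_continuous.
  apply: (@continuous_comp _ _ _ (fun v : 'cV[R]_p => v j 0) (fun x => `|x|)).
    exact: coord_continuous.
  exact: norm_continuous.
move=> b; apply: (continuousD (fit b)).
by apply: (continuousM _ (pen b)); exact: cst_continuous.
Qed.

Lemma pen_obj_min_exists (k : R) : 0 < k ->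
  (forall v : 'cV[R]_p, k * sqnorm v <= sqnorm (X *m v)) ->
  exists bs, forall b, f bs <= f b.
Proof.
move=> k0 kX.
(* Outside the box of radius [B], [sqnorm (X *m b)] is at least [4 * sqnorm y]; the residual is then
   at least [sqnorm y], the value of [f] at 0. *)
pose B := Num.sqrt (4 * sqnorm y / k).
have B2 : B ^+ 2 = 4 * sqnorm y / k.
  by rewrite sqr_sqrtr // divr_ge0 ?(ltW k0) // mulr_ge0 // sqnorm_ge0.
have f0 : f 0 = sqnorm y.
  rewrite /pen_obj mulmx0 subr0 big1 ?mulr0 ?addr0 // => j _.
  by rewrite mxE normr0 mulr0.
have box0 : [set v : 'cV[R]_p | forall j, `|v j 0| <= B] 0.
  by move=> j; rewrite mxE normr0 sqrtr_ge0.
have [bs _ bsmin] := compact_EVT_min (ex_intro _ _ box0) (@cV_box_compact R p B)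
  (continuous_subspaceT pen_obj_continuous).
exists bs => b.
have [bB|] := pselect (forall j, `|b j 0| <= B); first exact: bsmin (mem_set bB).
move=> /existsNP[j /negP]; rewrite -ltNge => Bb.
apply: le_trans (bsmin _ (mem_set box0)) _; rewrite f0.
have h1 : 4 * sqnorm y <= k * sqnorm b.
  rewrite -ler_pdivrMl // mulrC -B2 (le_trans _ (sqr_coord_le_sqnorm b j)) //.
  by rewrite -[leRHS]real_normK ?num_real // lerXn2r ?nnegrE ?sqrtr_ge0 ?(ltW Bb).
have h2 : sqnorm (X *m b) <= 2 * sqnorm (y - X *m b) + 2 * sqnorm y.
  rewrite !mulr_sumr -big_split /=; apply: ler_sum => i _.
  rewrite [(y - X *m b) i 0]mxE [(- (X *m b)) i 0]mxE.
  have := sqr_ge0 ((X *m b) i 0 - 2 * y i 0); nra.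
have h3 : 0 <= \sum_j wt j * `|b j 0| by apply: sumr_ge0 => i _; exact: mulr_ge0.
have := kX b; rewrite /pen_obj; lra.
Qed.

End penalized_least_squares.

(** * Measurability of the estimator *)

Lemma nbhs_ratr_cV (R : realType) (p : nat) (b : 'cV[R]_p) (A : set 'cV[R]_p) :
  nbhs b A -> exists q : 'cV[rat]_p, A (map_mx ratr q).
Proof.
move=> /nbhs_ballP[e e0 bA].
have /choice[q bq] : forall j, exists q : rat, `|b j 0 - ratr q| < e.
  move=> j; have [|q] := @rat_in_itvoo R (b j 0 - e) (b j 0 + e).
    by rewrite ltrD2l gtrN.
  by rewrite in_itv /= => /andP[h1 h2]; exists q; rewrite ltr_norml; lra.
exists (\col_j q j); apply: bA; split=> // j i.
by rewrite !mxE ord1 -ball_normE /=; exact: bq.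
Qed.

(** Quadratic growth forces near-minimisers to be close to [bs], so membership in a closed set can
    be tested on rational vectors, by countably many comparisons of objective values. This is what
    makes events about the minimiser measurable. *)
Lemma min_in_closed_rat (R : realType) (p : nat) (f : 'cV[R]_p -> R) (k : R)
    (S : set 'cV[R]_p) (bs : 'cV[R]_p) :
  closed S -> continuous f -> 0 < k ->
  (forall b, f bs + k * sqnorm (b - bs) <= f b) ->
  S bs <-> forall m : nat, exists q : 'cV[rat]_p,
    (exists2 s, S s & forall j, `|ratr (q j 0) - s j 0| < m.+1%:R^-1) /\
    forall q' : 'cV[rat]_p,
      f (map_mx ratr q) <= f (map_mx ratr q') + m.+1%:R^-1.
Proof.
move=> Scl fc k0 fk.
have bsmin b : f bs <= f b.
  by apply: le_trans (fk b); rewrite lerDl mulr_ge0 ?sqnorm_ge0 // ltW.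
have fnear (e : R) : 0 < e -> nbhs bs [set b | f b < f bs + e].
  move=> e0; have /cvgrPdist_lt/(_ _ e0) := fc bs.
  by apply: filterS => b /=; rewrite distrC => /ltr_normlP[_ h]; lra.
split=> [Sbs m|h].
  have m0 : 0 < m.+1%:R^-1 :> R by rewrite invr_gt0.
  have [|q [q1 q2]] := @nbhs_ratr_cV _ _ bs ([set b | f b < f bs + m.+1%:R^-1]
      `&` [set b | forall j, `|b j 0 - bs j 0| < m.+1%:R^-1]).
    apply: filterI; first exact: fnear.
    apply/nbhs_ballP; exists m.+1%:R^-1 => // b [_ bb] j.
    by have := bb j 0; rewrite -ball_normE /= distrC.
  exists q; split; first by exists bs => // j; have := q2 j; rewrite mxE.
  move=> q'; apply: le_trans (ltW q1) _; by rewrite lerD2r.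
apply: contrapT => nS.
have [e e0 bse] : exists2 e : R, 0 < e & ball bs e `<=` ~` S.
  by have /nbhs_ballP[e] := open_nbhs_nbhs (conj (closed_openC Scl) nS); exists e.
(* Half of the radius [e] goes to the distance from [q] to [s], half to that from [q] to [bs]. For
   the latter the slack is spent twice, for [q] against [q'] and for [q'] against [bs], whence the
   final factor 1/2. *)
have ek0 : 0 < Num.min (e / 2) (k * (e / 2) ^+ 2 / 2).
  by rewrite lt_min !divr_gt0 //= mulr_gt0 // exprn_gt0 // divr_gt0.
have [m _ /(_ m (leqnn m)) /=] := near_infty_natSinv_lt (PosNum ek0).
rewrite lt_min => /andP[m1 m2].
have [q [[s Ss qs] qmin]] := h m.
have [q' fq'] := nbhs_ratr_cV (fnear m.+1%:R^-1 ltac:(by rewrite invr_gt0)).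
have bound j : `|bs j 0 - ratr (q j 0)| < e / 2.
  have := le_trans (sqr_coord_le_sqnorm (map_mx ratr q - bs) j) (lexx _).
  have := fk (map_mx ratr q); have := qmin q'; move: fq' => /= fq' h1 h2.
  have h3 : sqnorm (map_mx ratr q - bs) < (e / 2) ^+ 2.
    rewrite -(ltr_pM2l k0); move: m2 fq' h1 h2.
    move: (k * (e / 2) ^+ 2) (k * sqnorm _) (f (map_mx ratr q)).
    move: (f (map_mx ratr q')) (f bs) m.+1%:R^-1.
    by move=> *; lra.
  move=> /le_lt_trans/(_ h3); rewrite !mxE.
  rewrite -[X in X < _ -> _]real_normK ?num_real // distrC.
  by rewrite ltr_pXn2r ?nnegrE // ltW // divr_gt0.
apply: (bse s) => //; split=> // j i; rewrite ord1 -ball_normE /=.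
rewrite -(subrKA (ratr (q j 0))) (le_lt_trans (ler_normD _ _)) //.
by rewrite [ltRHS]splitr ltrD ?(lt_trans (qs j)) //; exact: bound.
Qed.

(** Inversion is continuous off 0, and on a singleton every function is measurable. *)
Lemma measurable_funV (R : realType) : measurable_fun setT (@GRing.inv R).
Proof.
rewrite -(setvU [set (0 : R)]); apply/measurable_funU => //.
  exact: measurableC.
split; last exact: measurable_fun_set1.
apply: measurable_realfun.open_continuous_measurable_fun.
  by apply: closed_openC; exact: closed_eq.
move=> x; rewrite inE => /eqP x0; exact: inv_continuous.
Qed.

Section measurability.
Variables (R : realType) (d : measure_display) (T : measurableType d).
Variables (n p : nat) (X : 'M[R]_(n, p)) (lam : 'I_p -> R) (y : T -> 'cV[R]_n).
Hypothesis my : forall i, measurable_fun setT (fun w => y w i 0).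

Lemma mulmx_coord_measurable (m : nat) (A : 'M[R]_(m, n)) i :
  measurable_fun setT (fun w => (A *m y w) i 0).
Proof.
under eq_fun do rewrite mxE; apply: measurable_sum => k.
by apply: measurable_funM => //; exact: measurable_cst.
Qed.

Lemma LSest_measurable j : measurable_fun setT (fun w => LSest X (y w) j 0).
Proof.
by under eq_fun do rewrite /LSest mulmxA; exact: mulmx_coord_measurable.
Qed.

Lemma AL_obj_measurable (b : 'cV[R]_p) :
  measurable_fun setT (fun w => AL_obj X lam (y w) b).
Proof.
apply: measurable_funD.
  apply: measurable_sum => i; apply: (@measurable_funX _ _ _ _ _ 2).
  under eq_fun do rewrite mxE.
  by apply: measurable_funD => //; exact: measurable_cst.
apply: measurable_funM; first exact: measurable_cst.
apply: measurable_sum => j; apply: measurable_funM; first exact: measurable_cst.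
apply: (measurableT_comp (@measurable_funV R)).
by apply: measurableT_comp => //; exact: LSest_measurable.
Qed.

Hypothesis lam_ge0 : forall j, 0 <= lam j.
Variable k : R.
Hypothesis k_gt0 : 0 < k.
Hypothesis Xk : forall v : 'cV[R]_p, k * sqnorm v <= sqnorm (X *m v).

Let weight_ge0 w j : 0 <= lam j / `|LSest X (y w) j 0|.
Proof. by rewrite divr_ge0. Qed.

Lemma is_AL_exists w : exists b, is_AL X lam (y w) b.
Proof.
have [b bmin] := pen_obj_min_exists (y w) (weight_ge0 w) k_gt0 Xk.
by exists b => b'; rewrite !AL_objE.
Qed.

Lemma is_AL_sqnorm w b bs : is_AL X lam (y w) bs ->
  AL_obj X lam (y w) bs + k / 2 * sqnorm (b - bs) <= AL_obj X lam (y w) b.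
Proof.
move=> bsmin; rewrite !AL_objE.
apply: le_trans (pen_obj_strong_convex (weight_ge0 w) _ _); last first.
  by move=> b'; rewrite -!AL_objE.
by rewrite lerD2l mulrAC ler_pM2r // Xk.
Qed.

Lemma is_AL_uniq w b b' : is_AL X lam (y w) b -> is_AL X lam (y w) b' -> b = b'.
Proof.
move=> hb hb'; apply/eqP; rewrite -subr_eq0; apply: contraT => /sqnorm_gt0 s0.
have := is_AL_sqnorm b hb'; have := hb b'.
have : 0 < k / 2 * sqnorm (b - b') by rewrite mulr_gt0 // divr_gt0.
lra.
Qed.

(** By [min_in_closed_rat] the event is built by countable intersections and unions from comparisons
    of objective values at rational points, each of which is measurable in [w]. *)
Lemma AL_event_closed_measurable (S : set 'cV[R]_p) : closed S ->
  measurable [set w | exists2 b, is_AL X lam (y w) b & S b].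
Proof.
move=> Scl.
pose near_S m (q : 'cV[rat]_p) :=
  exists2 s, S s & forall j, `|ratr (q j 0) - s j 0| < m.+1%:R^-1.
pose F w (q : 'cV[rat]_p) := AL_obj X lam (y w) (map_mx ratr q).
have -> : [set w | exists2 b, is_AL X lam (y w) b & S b] =
    \bigcap_m \bigcup_(q : 'cV[rat]_p) ([set w | near_S m q] `&`
      ~` \bigcup_(q' : 'cV[rat]_p) [set w | F w q > F w q' + m.+1%:R^-1]).
  apply/seteqP; split=> w /=.
    move=> [bs bsmin Sbs] m _.
    have fc : continuous (AL_obj X lam (y w)).
      by rewrite (funext (AL_objE X lam (y w))); exact: pen_obj_continuous.
    have [/(_ Sbs m)[q [qS qmin]] _] := min_in_closed_rat Scl fc
      (divr_gt0 k_gt0 (ltr0n _ 2)) (fun b => is_AL_sqnorm b bsmin).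
    exists q => //; split=> // -[q' _] /=.
    by rewrite ltNge; apply/negP; rewrite negbK; exact: qmin.
  move=> h; have [bs bsmin] := is_AL_exists w; exists bs => //.
  have fc : continuous (AL_obj X lam (y w)).
    by rewrite (funext (AL_objE X lam (y w))); exact: pen_obj_continuous.
  apply/(min_in_closed_rat Scl fc (divr_gt0 k_gt0 (ltr0n _ 2))
    (fun b => is_AL_sqnorm b bsmin)) => m.
  have [q _ [qS qmin]] := h m Logic.I; exists q; split=> // q'.
  by rewrite leNgt; apply/negP => qq'; apply: qmin; exists q'.
apply: bigcapT_measurable => m; apply: countable_bigcupT_measurable => // q.
apply: measurableI.
  (* [near_S m q] does not depend on [w], so this set is everything or empty. *)
  have [hq|hq] := pselect (near_S m q).
    by rewrite (_ : [set w | _] = setT) //; apply/seteqP; split.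
  by rewrite (_ : [set w | _] = set0) //; apply/seteqP; split.
apply: measurableC; apply: countable_bigcupT_measurable => // q'.
have mG : measurable_fun setT (fun w => F w q' + m.+1%:R^-1).
  apply: measurable_funD; first exact: AL_obj_measurable.
  exact: measurable_cst.
have := measurable_fun_ltr mG (AL_obj_measurable (map_mx ratr q)).
by move=> /(_ measurableT [set true] Logic.I); rewrite setTI.
Qed.

End measurability.

(** * Anti-concentration and tightness *)

Section characteristic_functions.
Variables (R : realType) (d : measure_display) (T : measurableType d).
Variable P : probability T R.

Lemma bounded_integrable (g : T -> R) (M : R) :
  measurable_fun setT g -> (forall w, `|g w| <= M) ->
  P.-integrable setT (EFin \o g).
Proof.
move=> mg gM; apply: measurable_bounded_integrable => //.
  by apply: le_lt_trans (probability_le1 P measurableT) _; rewrite ltry.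
exists M; split; first by rewrite num_real.
by move=> x Mx w _ /=; exact: le_trans (gM w) (ltW Mx).
Qed.

Lemma cosM_measurable (Y : T -> R) (s : R) : measurable_fun setT Y ->
  measurable_fun setT (fun w => cos (s * Y w)).
Proof.
move=> mY; apply: (measurableT_comp (continuous_measurable_fun
  (@continuous_cos R))).
by apply: measurable_funM => //; exact: measurable_cst.
Qed.

Lemma sinM_measurable (Y : T -> R) (s : R) : measurable_fun setT Y ->
  measurable_fun setT (fun w => sin (s * Y w)).
Proof.
move=> mY; apply: (measurableT_comp (continuous_measurable_fun
  (@continuous_sin R))).
by apply: measurable_funM => //; exact: measurable_cst.
Qed.

Lemma sin_norm_le1 (x : R) : `|sin x| <= 1.
Proof. by rewrite ler_norml sin_le1 sin_geN1. Qed.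

Lemma markov_set (A : set T) (g : T -> \bar R) (c : R) :
  measurable A -> 0 < c -> measurable_fun setT g ->
  (forall w, (0 <= g w)%E) -> (forall w, A w -> (c%:E <= g w)%E) ->
  (c%:E * P A <= \int[P]_w g w)%E.
Proof.
move=> mA c0 mg g0 gc; have -> : (c%:E * P A = \int[P]_w (c * \1_A w)%:E)%E.
  under eq_integral do rewrite EFinM.
  rewrite ge0_integralZl //; first by rewrite integral_indic // setIT.
  - by apply/measurable_EFinP; exact: measurable_indic.
  - by rewrite lee_fin ltW.
apply: ge0_le_integral => //.
- by move=> w _; rewrite lee_fin mulr_ge0 // ltW.
- apply/measurable_EFinP; apply: measurable_funM; first exact: measurable_cst.
  exact: measurable_indic.
move=> w _; rewrite indicE; case: (boolP (w \in A)) => [/set_mem/gc|_].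
  by rewrite mulr1.
by rewrite mulr0.
Qed.

Lemma Rintegral_sum (I : Type) (r : seq I) (g : I -> T -> R) :
  (forall i, P.-integrable setT (EFin \o g i)) ->
  P.-integrable setT (EFin \o (fun w => \sum_(i <- r) g i w)) /\
  \int[P]_w (\sum_(i <- r) g i w) = \sum_(i <- r) \int[P]_w g i w.
Proof.
move=> ig; elim: r => [|i r [ih1 ih2]].
  rewrite big_nil (_ : (fun w => _) = cst 0); last first.
    by apply/funext => w; rewrite big_nil.
  by split; [exact: integrable0 | rewrite Rintegral_cst // mul0r].
rewrite big_cons -ih2 (_ : (fun w => \sum_(j <- i :: r) g j w) =
  (fun w => g i w + \sum_(j <- r) g j w)); last first.
  by apply/funext => w; rewrite big_cons.
by split; [exact: (integrableD measurableT (ig i) ih1) | rewrite RintegralD].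
Qed.

Variables (Y : nat -> T -> R) (tau : R).
Hypothesis mY : forall n, measurable_fun setT (Y n).
Hypothesis cf_cos : forall s,
  (fun n => \int[P]_w (cos (s * Y n w))%:E)%E @ \oo -->
  (expR (- (tau * s ^+ 2)))%:E.
Hypothesis cf_sin : forall s,
  (fun n => \int[P]_w (sin (s * Y n w))%:E)%E @ \oo --> 0%E.

Let Ecos n s := \int[P]_w cos (s * Y n w).
Let Esin n s := \int[P]_w sin (s * Y n w).

Let cos_int n s : P.-integrable setT (EFin \o (fun w => cos (s * Y n w))).
Proof.
by apply: (@bounded_integrable _ 1); [exact: cosM_measurable|move=> w; exact: cos_max].
Qed.

Let sin_int n s : P.-integrable setT (EFin \o (fun w => sin (s * Y n w))).
Proof.
apply: (@bounded_integrable _ 1); first exact: sinM_measurable.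
by move=> w; exact: sin_norm_le1.
Qed.

Let shift_int n s a : P.-integrable setT
  (EFin \o (fun w => cos (s * (a + Y n w)))).
Proof.
apply: (@bounded_integrable _ 1); last by move=> w; exact: cos_max.
apply: (@cosM_measurable (fun w => a + Y n w)).
by apply: measurable_funD => //; exact: measurable_cst.
Qed.

(** Addition formula; the bound is free of [a], which is the source of uniformity over shifts. *)
Let cos_shift_bound n s a :
  \int[P]_w cos (s * (a + Y n w)) <= `|Ecos n s| + `|Esin n s|.
Proof.
have -> : \int[P]_w cos (s * (a + Y n w)) =
    cos (s * a) * Ecos n s + - sin (s * a) * Esin n s.
  rewrite -!RintegralZl // -RintegralD //.
  - by apply: eq_Rintegral => w _; rewrite mulrDr cosD mulNr.
  - have := integrableZl measurableT (cos (s * a)) (cos_int n s).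
    by apply: eq_integrable => // w _ /=; rewrite EFinM.
  - have := integrableZl measurableT (- sin (s * a)) (sin_int n s).
    by apply: eq_integrable => // w _ /=; rewrite EFinM.
apply: lerD; apply: le_trans (ler_norm _) _; rewrite normrM ler_piMl //.
  exact: cos_max.
by rewrite normrN sin_norm_le1.
Qed.

(* The squared modulus of [\sum_(k < N) expi (M k x)], which is at least
   [(N cos 1)^2] near [0]; expanding it leaves only [N] diagonal terms that do
   not decay when [M] is large. *)
Let fejer (N : nat) (M x : R) :=
  \sum_(k < N) \sum_(l < N) cos ((M * (k%:R - l%:R)) * x).

Let fejerE N M x :
  fejer N M x = (\sum_(k < N) cos (M * k%:R * x)) ^+ 2
              + (\sum_(k < N) sin (M * k%:R * x)) ^+ 2.
Proof.
rewrite !expr2 !mulr_suml -big_split; apply: eq_bigr => k _ /=.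
rewrite !mulr_sumr -big_split; apply: eq_bigr => l _ /=.
by rewrite mulrBr mulrBl cosB.
Qed.

(** All phases [M * k%:R * x] with [k < N] lie in [-1, 1], where the cosine is at least [cos 1]. *)
Let fejer_lower N M x : (0 < N)%N -> 0 < M -> `|x| <= (M * N%:R)^-1 ->
  (N%:R * cos 1) ^+ 2 <= fejer N M x.
Proof.
move=> N0 M0 xM; rewrite fejerE; apply: ler_wpDr; first exact: sqr_ge0.
have c1 := @cos1_gt0 R.
have cos_ge (k : 'I_N) : cos 1 <= cos (M * k%:R * x).
  have y1 : `|M * k%:R * x| <= 1.
    rewrite !normrM (gtr0_norm M0) ger0_norm // (@le_trans _ _
      (M * N%:R * `|x|)) //.
      by rewrite ler_wpM2r // ler_pM2l // ler_nat ltnW.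
    rewrite -[leRHS](@mulfV _ (M * N%:R)) ?ler_pM2l ?mulr_gt0 ?ltr0n //.
    by rewrite mulf_neq0 ?gt_eqF ?ltr0n.
  have pi1 : 1 <= pi :> R by rewrite (le_trans _ (@pi_ge2 R)) // ler1n.
  rewrite -(cos_norm (_ * x)) leNgt ltr_cos -?leNgt // in_itv /=.
    by rewrite ler01 pi1.
  by rewrite normr_ge0 (le_trans y1 pi1).
have cos_sum : N%:R * cos 1 <= \sum_(k < N) cos (M * k%:R * x).
  rewrite (@le_trans _ _ (\sum_(k < N) cos 1)) //; last exact: ler_sum.
  by rewrite sumr_const card_ord mulr_natl.
rewrite lerXn2r ?nnegrE ?mulr_ge0 ?(ltW c1) //.
by rewrite (le_trans _ cos_sum) // mulr_ge0 // ltW.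
Qed.

(** Markov's inequality for [fejer]: its mean is at most [2 * N%:R], against the lower bound
    [(N%:R * cos 1) ^+ 2] near 0, so the probability is at most [2 / (N%:R * cos 1 ^+ 2)]. *)
Lemma anticoncentration (e : R) : 0 < tau -> 0 < e ->
  exists2 eta : R, 0 < eta & \forall n \near \oo, forall a,
    (P [set w | `|a + Y n w| < eta]%R <= e%:E)%E.
Proof.
move=> tau0 e0; have c1 := @cos1_gt0 R.
pose N := (Num.truncn (2 / (e * cos 1 ^+ 2))).+1.
have N0 : 0 < N%:R :> R by rewrite ltr0n.
have N_large : 2 / (N%:R * cos 1 ^+ 2) <= e.
  have := truncnS_gt (2 / (e * cos 1 ^+ 2)); rewrite -/N => h.
  have c2 : 0 < cos 1 ^+ 2 :> R by rewrite exprn_gt0.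
  rewrite ler_pdivrMr ?mulr_gt0 // mulrCA mulrA.
  by move: h; rewrite ltr_pdivrMr ?mulr_gt0 // => /ltW; rewrite mulrA [N%:R * e]mulrC.
(* At every frequency of modulus at least [M] the limiting characteristic function is below
   [N%:R^-1]; the estimate used is [1 + x <= expR x]. *)
have [M M1 Msmall] : exists2 M : R, 1 <= M & expR (- (tau * M ^+ 2)) < N%:R^-1.
  have Nt0 : 0 < N%:R / tau by rewrite divr_gt0.
  exists (1 + N%:R / tau); first by rewrite lerDl ltW.
  rewrite expRN ltf_pV2 ?posrE ?expR_gt0 //.
  apply: lt_le_trans (expR_ge1Dx _).
  rewrite [ltLHS](_ : _ = tau * (N%:R / tau)); last first.
    by rewrite mulrCA mulfV ?mulr1 ?gt_eqF.
  move: (N%:R / tau) Nt0 => z z0; have := mulr_gt0 tau0 z0.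
  have := mulr_gt0 tau0 (mulr_gt0 z0 z0); nra.
have M0 : 0 < M by apply: lt_le_trans M1.
(* Distinct indices differ by at least 1, so the frequency [s] has modulus at least [M]. The pairs
   are finite in number, hence one threshold for [n] serves every [a]. *)
have offdiag (k l : 'I_N) : \forall n \near \oo, k != l ->
    `|Ecos n (M * (k%:R - l%:R))| + `|Esin n (M * (k%:R - l%:R))| < N%:R^-1.
  have [_|kl] := eqVneq k l; first by apply: nearW.
  set s := M * (k%:R - l%:R).
  have sM : M ^+ 2 <= s ^+ 2.
    rewrite exprMn ler_peMr ?sqr_ge0 //.
    have : (1 <= `|k%:R - l%:R| :> R).
      have : (k != l :> nat) by [].
      rewrite neq_ltn => /orP[] h.
        by rewrite distrC ger0_norm ?subr_ge0 ?ler_nat ?(ltnW h) //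
          -natrB ?(ltnW h) // ler1n subn_gt0.
      by rewrite ger0_norm ?subr_ge0 ?ler_nat ?(ltnW h) //
        -natrB ?(ltnW h) // ler1n subn_gt0.
    by rewrite -[X in _ -> _ <= X]real_normK ?num_real // => h; exact: exprn_ege1.
  have lim : `|Ecos n s| + `|Esin n s| @[n --> \oo] -->
      `|expR (- (tau * s ^+ 2))| + `|0 : R|.
    have lc : Ecos n s @[n --> \oo] --> expR (- (tau * s ^+ 2)).
      exact: fine_cvg (@cf_cos s).
    have ls : Esin n s @[n --> \oo] --> (0 : R) by exact: fine_cvg (@cf_sin s).
    exact: cvgD (cvg_norm lc) (cvg_norm ls).
  have : `|expR (- (tau * s ^+ 2))| + `|0 : R| < N%:R^-1.
    rewrite normr0 addr0 gtr0_norm ?expR_gt0 // (le_lt_trans _ Msmall) //.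
    by rewrite ler_expR lerN2 ler_pM2l.
  by move=> h; apply: filterS (cvgr_lt _ lim _ h) => n hn _.
exists (M * N%:R)^-1; first by rewrite invr_gt0 mulr_gt0.
have : \forall n \near \oo, forall k l : 'I_N, k != l ->
    `|Ecos n (M * (k%:R - l%:R))| + `|Esin n (M * (k%:R - l%:R))| < N%:R^-1.
  by apply: filter_forall => k; apply: filter_forall => l; exact: offdiag.
apply: filterS => n off a.
set A := [set w | _].
have mA : measurable A.
  have ma : measurable_fun setT (fun w => `|a + Y n w|).
    apply: measurableT_comp => //.
    by apply: measurable_funD => //; exact: measurable_cst.
  have := measurable_fun_ltr ma (measurable_cst (M * N%:R)^-1).
  by move=> /(_ measurableT [set true] Logic.I); rewrite setTI.
have mf : measurable_fun setT (fun w => fejer N M (a + Y n w)).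
  apply: measurable_sum => k; apply: measurable_sum => l.
  apply: (@cosM_measurable (fun w => a + Y n w)).
  by apply: measurable_funD => //; exact: measurable_cst.
have f0 w : 0 <= fejer N M (a + Y n w) by rewrite fejerE addr_ge0 ?sqr_ge0.
have := markov_set mA (exprn_gt0 2 (mulr_gt0 N0 c1))
  ((measurable_EFinP _ _).2 mf) (fun w => f0 w).
move=> /(_ (fun w Aw => fejer_lower (ltn0Sn _) M0 (ltW Aw))).
have int2 k : P.-integrable setT (EFin \o (fun w =>
   \sum_(l < N) cos (M * (k%:R - l%:R) * (a + Y n w)))).
  by have [] := @Rintegral_sum _ (index_enum 'I_N) (fun (l : 'I_N) w =>
     cos (M * (k%:R - l%:R) * (a + Y n w))) (fun l => shift_int _ _ _).
have [intf intE] := @Rintegral_sum _ (index_enum 'I_N) (fun (k : 'I_N) w =>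
   \sum_(l < N) cos (M * (k%:R - l%:R) * (a + Y n w))) (fun k => int2 k).
(* In each row the diagonal term contributes 1 and the other terms together at most
   [N%:R * N%:R^-1 = 1]. *)
have bound : \int[P]_w fejer N M (a + Y n w) <= 2 * N%:R.
  rewrite intE (@le_trans _ _ (\sum_(k < N) 2)) //; last first.
    by rewrite sumr_const card_ord mulr_natr.
  apply: ler_sum => k _.
  have [_ ->] := @Rintegral_sum _ (index_enum 'I_N) (fun (l : 'I_N) w =>
     cos (M * (k%:R - l%:R) * (a + Y n w))) (fun l => shift_int _ _ _).
  rewrite (bigD1 k) //= -[leRHS]/(1 + 1) lerD //.
    rewrite subrr mulr0; under eq_Rintegral do rewrite mul0r cos0.
    rewrite Rintegral_cst // mul1r.
    by rewrite (congr1 fine (probability_setT P)).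
  apply: (@le_trans _ _ (\sum_(l < N | l != k) N%:R^-1)).
    apply: ler_sum => l lk; apply: le_trans (cos_shift_bound _ _ _) _.
    by apply: ltW; apply: off; rewrite eq_sym.
  rewrite (@le_trans _ _ (\sum_(l < N) N%:R^-1)) //.
    rewrite [leRHS](bigD1 k) //= lerDr invr_ge0 ltW //.
  by rewrite sumr_const card_ord -[N%:R^-1 *+ N]mulr_natl mulfV // gt_eqF.
move=> h; have : (((N%:R * cos 1) ^+ 2)%:E * P A <= (2 * N%:R)%:E)%E.
  apply: le_trans h _; rewrite -[leLHS]fineK; first by rewrite lee_fin.
  exact: integrable_fin_num intf.
rewrite -[P A]fineK ?fin_num_measure // -EFinM !lee_fin => hp.
apply: le_trans N_large; rewrite ler_pdivlMr ?mulr_gt0 ?exprn_gt0 //.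
rewrite -(ler_pM2l N0); apply: le_trans (_ : _ <= 2 * N%:R) _; last by rewrite mulrC.
by apply: le_trans hp; rewrite exprMn; nra.
Qed.
End characteristic_functions.

(** * Tightness from averaged cosines *)

Lemma integral_onem_cos (R : realType) (u x : R) : 0 < u -> x != 0 ->
  (\int[lebesgue_measure]_(s in `[0%R, u]) (1 - cos (s * x))%:E =
   (u - sin (u * x) / x)%:E)%E.
Proof.
move=> u0 x0; pose F (s : R) := s - x^-1 * sin (s * x).
have dF (s : R) : is_derive s 1 F (1 - cos (s * x)).
  have d1 : is_derive s (1 : R) (fun s : R => s * x) x.
    by apply: is_derive_eq; rewrite scaler0 add0r /GRing.scale /= mulr1.
  have d2 := @is_derive1_comp R sin (fun s => s * x) s _ _
    (is_derive_sin (s * x)) d1.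
  have d3 := is_deriveZ x^-1 d2.
  have d4 := is_deriveB (is_derive_id s (1 : R)) d3.
  by apply: is_derive_eq d4 _; rewrite /GRing.scale /= mulrCA mulVf ?mulr1.
have cF s : {for s, continuous F}.
  apply: differentiable_continuous; apply/derivable1_diffP.
  exact: (@ex_derive _ _ _ _ _ _ _ (dF s)).
rewrite (@continuous_FTC2 _ _ F) //.
- by rewrite /F !mul0r sin0 mulr0 subr0 sube0 [_ / x]mulrC.
- apply: continuous_subspaceT => s; apply: continuousB.
    exact: cst_continuous.
  apply: (@continuous_comp _ _ _ (fun s : R => s * x) cos).
    by apply: continuousM; [exact: cvg_id|exact: cst_continuous].
  exact: continuous_cos.
- split; first by move=> s _; exact: (@ex_derive _ _ _ _ _ _ _ (dF s)).
    by apply: cvg_at_right_filter; exact: cF.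
  by apply: cvg_at_left_filter; exact: cF.
- by move=> s _; rewrite derive1E; exact: (@derive_val _ _ _ _ _ _ _ (dF s)).
Qed.

Section tightness.
Variables (R : realType) (d : measure_display) (T : measurableType d).
Variable P : probability T R.
Local Notation mu := (@lebesgue_measure R).

Variables (Y : nat -> T -> R) (tau : R).
Hypothesis mY : forall n, measurable_fun setT (Y n).
Hypothesis cf_cos : forall s,
  (fun n => \int[P]_w (cos (s * Y n w))%:E)%E @ \oo -->
  (expR (- (tau * s ^+ 2)))%:E.

Let h n (z : R * T) : \bar R := (1 - cos (z.1 * Y n z.2))%:E.

Let h_ge0 n z : (0 <= h n z)%E.
Proof. by rewrite lee_fin subr_ge0 cos_le1. Qed.

Let h_measurable n : measurable_fun setT (h n).
Proof.
apply/measurable_EFinP; apply: measurable_funB; first exact: measurable_cst.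
apply: (measurableT_comp (continuous_measurable_fun (@continuous_cos R))).
by apply: measurable_funM => //; exact: measurableT_comp.
Qed.

Let D (u : R) := `[0%R, u]%classic.

(** Extends [h] by zero outside [D u], so that Tonelli applies on the whole product space. *)
Let g n u (z : R * T) := (h n z * (\1_(D u) z.1)%:E)%E.

Let g_ge0 n u z : (0 <= g n u z)%E.
Proof. by rewrite mule_ge0. Qed.

Let g_measurable n u : measurable_fun setT (g n u).
Proof.
apply: emeasurable_funM => //; apply/measurable_EFinP.
have m1 : measurable_fun setT (\1_(D u) : R -> R).
  by apply: measurable_indic; exact: measurable_itv.
exact: (measurableT_comp m1 measurable_fst).
Qed.

Let gE n u s w : g n u (s, w) = ((fun s => h n (s, w)) \_ (D u)) s.
Proof.
rewrite /g patchE indicE; case: ifP => _; first by rewrite mule1.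
by rewrite mule0.
Qed.

Let integral_h_measurable n u :
  measurable_fun setT (fun w => \int[mu]_(s in D u) h n (s, w))%E.
Proof.
have := @measurable_fun_fubini_tonelli_G _ _ _ _ _ mu _
  (@g_measurable n u) (g_ge0 n u).
congr measurable_fun; apply/funext => w; rewrite [RHS]integral_mkcond.
by apply: eq_integral => s _; rewrite gE.
Qed.

Let integral_h_swap n u :
  (\int[mu]_(s in D u) \int[P]_w h n (s, w) =
   \int[P]_w \int[mu]_(s in D u) h n (s, w))%E.
Proof.
have := @fubini_tonelli _ _ _ _ _ mu P (g n u) (@g_measurable n u) (g_ge0 n u).
under eq_integral => s _.
  rewrite (_ : (\int[P]_w g n u (s, w) =
               ((fun s => \int[P]_w h n (s, w)) \_ (D u)) s)%E).
    over.
  rewrite patchE; case: ifP => sD.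
    by apply: eq_integral => w _; rewrite gE patchE sD.
  by rewrite integral0_eq // => w _; rewrite gE patchE sD.
rewrite -integral_mkcond => ->.
apply: eq_integral => w _; rewrite [RHS]integral_mkcond.
by apply: eq_integral => s _; rewrite gE.
Qed.

Let integral_h n s :
  (\int[P]_w h n (s, w) = (1 - \int[P]_w cos (s * Y n w))%:E)%E.
Proof.
have mc := @cosM_measurable _ _ _ (Y n) s (mY n).
have ic : P.-integrable setT (EFin \o (fun w => cos (s * Y n w))).
  by apply: (@bounded_integrable _ _ _ _ _ 1) => // w; exact: cos_max.
have i1 : P.-integrable setT (EFin \o (fun=> 1 : R)).
  by apply: (@bounded_integrable _ _ _ _ _ 1) => // w; rewrite normr1.
rewrite -[LHS]fineK.
  congr EFin; rewrite -[LHS]/(\int[P]_w (1 - cos (s * Y n w))).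
  rewrite RintegralB // Rintegral_cst // mul1r.
  by rewrite (congr1 fine (probability_setT P)).
apply: integrable_fin_num => //; apply: (@bounded_integrable _ _ _ _ _ 2).
  by apply: measurable_funB => //; exact: measurable_cst.
by move=> w; have := cos_le1 (s * Y n w); have := cos_geN1 (s * Y n w);
  rewrite ler_norml; lra.
Qed.

(** Where [|Y n w| > 2 / u], the integral of [1 - cos (s * Y n w)] over [[0, u]] is at least
    [u / 2], while its mean converges to the integral of [1 - expR (- (tau * s ^+ 2))], of order
    [u ^+ 3]. Markov's inequality compares the two. *)
Lemma tightness (e : R) : 0 <= tau -> 0 < e ->
  exists2 K : R, 0 < K & \forall n \near \oo,
    (P [set w | K < `|Y n w|]%R <= e%:E)%E.
Proof.
move=> tau0 e0.
have t1 : 0 < 2 * (tau + 1) by rewrite mulr_gt0 // ltr_wpDl.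
(* Makes the final bound [2 * (tau + 1) * u ^+ 2] equal to [e]; [tau + 1] instead of [tau] leaves
   room for a strict inequality in the limit. *)
pose u := Num.sqrt (e / (2 * (tau + 1))).
have u0 : 0 < u by rewrite sqrtr_gt0 divr_gt0.
have u2 : 2 * (tau + 1) * u ^+ 2 = e.
  by rewrite sqr_sqrtr ?(ltW (divr_gt0 e0 t1)) // mulrCA mulfV ?mulr1 // gt_eqF.
exists (2 / u); first by rewrite divr_gt0.
have mD : measurable (D u) by exact: measurable_itv.
have muD : mu (D u) = u%:E by rewrite lebesgue_measure_itv /= lte_fin u0 oppr0 adde0.
pose f_ n s := (\int[P]_w h n (s, w))%E.
pose f (s : R) : \bar R := (1 - expR (- (tau * s ^+ 2)))%:E.
have mf_ n : measurable_fun (D u) (f_ n).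
  apply: measurable_funTS.
  exact: (@measurable_fun_fubini_tonelli_F _ _ _ _ _ P _ (@h_measurable n) (h_ge0 n)).
have f_f s : f_ ^~ s @ \oo --> f s.
  rewrite (_ : f_ ^~ s = EFin \o (fun n => 1 - \int[P]_w cos (s * Y n w))).
    apply: cvg_EFin; first exact: nearW.
    by apply: cvgB; [exact: cvg_cst|exact: fine_cvg (@cf_cos s)].
  by apply/funext => n; exact: integral_h.
have f_le2 n s : (`|f_ n s| <= (2 : R)%:E)%E.
  have c2 : (\int[P]_w cst (2 : R)%:E w = (2 : R)%:E)%E.
    by rewrite integral_cst // -[RHS]mule1 -(probability_setT P).
  rewrite gee0_abs ?integral_ge0 // -c2; apply: ge0_le_integral => //.
    apply: (measurableT_comp (@h_measurable n)).
    exact: measurable_pair1.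
  move=> w _; rewrite lee_fin; have := cos_geN1 (s * Y n w); lra.
have mf : measurable_fun (D u) f by apply: emeasurable_fun_cvg mf_ (fun s _ => f_f s).
have icst : mu.-integrable (D u) (cst (2 : R)%:E).
  apply: (@measurable_bounded_integrable _ _ _ _ (cst (2 : R))) => //.
    by rewrite [ltLHS]muD ltry.
  exists 2; split; first by rewrite num_real.
  by move=> x x2 w _ /=; rewrite ger0_norm // ltW.
have ae1 : {ae mu, forall s, D u s -> f_ ^~ s @ \oo --> f s}.
  by apply: aeW => s _; exact: f_f.
have ae2 : {ae mu, forall s n, D u s -> (`|f_ n s| <= cst (2 : R)%:E s)%E}.
  by apply: aeW => s n _; exact: f_le2.
have [_ _ lim] := @dominated_convergence _ _ _ mu _ mD f_ f _ mf_ mf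
  ae1 icst ae2.
have flim : (\int[mu]_(s in D u) f s < (u * (tau + 1) * u ^+ 2)%:E)%E.
  apply: (@le_lt_trans _ _ (\int[mu]_(s in D u) (tau * u ^+ 2)%:E)%E).
    apply: ge0_le_integral => //.
      by move=> s _; rewrite lee_fin subr_ge0 -expR0 ler_expR oppr_le0
        mulr_ge0 // sqr_ge0.
    move=> s; rewrite /D /= in_itv /= => /andP[s0 su]; rewrite lee_fin.
    have := expR_ge1Dx (- (tau * s ^+ 2)).
    have : tau * s ^+ 2 <= tau * u ^+ 2.
      by rewrite ler_wpM2l // lerXn2r // nnegrE ltW.
    lra.
  rewrite integral_cst // [X in (_ * X)%E]muD -EFinM lte_fin.
  by have := mulr_gt0 u0 (mulr_gt0 u0 u0); rewrite expr2; lra.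
have : \forall n \near \oo, (\int[mu]_(s in D u) f_ n s <
    (u * (tau + 1) * u ^+ 2)%:E)%E.
  by exact: (lim _ (open_ereal_lt' flim)).
apply: filterS => n; rewrite /f_ integral_h_swap => hn.
set A := [set w | _].
have mA : measurable A.
  have ma : measurable_fun setT (fun w => `|Y n w|) by exact: measurableT_comp.
  have := measurable_fun_ltr (measurable_cst (2 / u)) ma.
  by move=> /(_ measurableT [set true] Logic.I); rewrite setTI.
have u20 : 0 < u / 2 by rewrite divr_gt0.
have G0 w : (0 <= \int[mu]_(s in D u) h n (s, w))%E by exact: integral_ge0.
(* The integral equals [u - sin (u * Y n w) / Y n w], and on [A] the inverse of [|Y n w|] is at most
   [u / 2]. *)
have lower w : A w -> ((u / 2)%:E <= \int[mu]_(s in D u) h n (s, w))%E.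
  move=> Aw; have Y0 : 0 < `|Y n w| by apply: lt_trans Aw; rewrite divr_gt0.
  have Yn0 : Y n w != 0 by rewrite -normr_gt0.
  rewrite [leRHS](_ : _ = (u - sin (u * Y n w) / Y n w)%:E); last first.
    exact: (integral_onem_cos u0 Yn0).
  rewrite lee_fin.
  have : sin (u * Y n w) / Y n w <= u / 2.
    apply: le_trans (ler_norm _) _; rewrite normrM normfV.
    rewrite ler_pdivrMr //; apply: (@le_trans _ _ 1); first exact: sin_norm_le1.
    move: Aw => /= /ltW; rewrite -(ler_pM2l u20) => h1; apply: le_trans h1.
    by rewrite mulrA divfK ?divff ?gt_eqF.
  lra.
have h1 := @markov_set _ _ _ P _ _ _ mA u20 (@integral_h_measurable n u)
  G0 lower.
have := le_lt_trans h1 hn.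
rewrite -[P A]fineK ?fin_num_measure // -EFinM lte_fin lee_fin => hp.
rewrite -u2; rewrite -(ler_pM2l u20).
by apply: (le_trans (ltW hp)); lra.
Qed.
End tightness.

(** * Rescaled subgradient conditions *)

Lemma mx_entries_bounded (R : realType) (m n : nat) (A : 'M[R]_(m, n)) :
  exists2 c : R, 0 < c & forall i j, `|A i j| <= c.
Proof.
exists (1 + \sum_i \sum_j `|A i j|).
  by rewrite ltr_wpDr // sumr_ge0 // => i _; rewrite sumr_ge0.
move=> i j; rewrite ler_wpDl // (bigD1 i) //= (bigD1 j) //= -addrA lerDl.
by rewrite addr_ge0 // sumr_ge0 // => k _; rewrite ?sumr_ge0.
Qed.

Lemma mulmx_coord_bound (R : realType) (m p : nat) (A : 'M[R]_(m, p))
    (v : 'cV[R]_p) (c b : R) i :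
  (forall i j, `|A i j| <= c) -> (forall j, `|v j 0| <= b) ->
  `|(A *m v) i 0| <= p%:R * (c * b).
Proof.
move=> Ac vb; have := @mulmx_perturb R m p A 0 v c b i.
rewrite mul0mx [X in _ - X]mxE subr0.
by apply=> // k l; rewrite mxE subr0.
Qed.

(** The subgradient conditions concern the sample matrix [D] and [v], whereas [Mset] involves [C]
    and [v + z]. As [L] depends only on [C], [B] and the dimension, the transfer is uniform in the
    true parameter. *)
Lemma mulmx_qform_perturb (R : realType) (p : nat) (C : 'M[R]_p) (B : R) :
  0 <= B -> exists2 L : R, 0 < L & forall (D : 'M[R]_p) (v z : 'cV[R]_p) (t : R),
  0 <= t <= 1 -> (forall i j, `|D i j - C i j| <= t) ->
  (forall j, `|v j 0| <= B) -> (forall j, `|z j 0| <= t) ->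
  forall j, `|(C *m (v + z)) j 0 - (D *m v) j 0| <= L * t /\
    `|(v + z) j 0 * (C *m (v + z)) j 0 - v j 0 * (D *m v) j 0| <= L * t.
Proof.
move=> B0; have [c c0 Cc] := mx_entries_bounded C.
pose L1 := p%:R * (B + c); pose L2 := B * L1 + p%:R * (c * (B + 1)).
have p0 : 0 <= p%:R :> R by rewrite ler0n.
have L10 : 0 <= L1 by rewrite mulr_ge0 // addr_ge0 // ltW.
have L20 : 0 <= L2.
  by rewrite addr_ge0 // !mulr_ge0 // ?addr_ge0 // ltW.
exists (1 + L1 + L2); first by rewrite -addrA ltr_wpDr // addr_ge0.
move=> D v z t /andP[t0 t1] DC vB zt j.
have h1 : `|(C *m (v + z)) j 0 - (D *m v) j 0| <= L1 * t.
  rewrite mulmxDr mxE addrAC (le_trans (ler_normD _ _)) //.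
  rewrite /L1 mulrDr mulrDl lerD //.
    rewrite distrC (le_trans (@mulmx_perturb _ _ _ D C v t B j DC vB)) //.
    by rewrite [t * B]mulrC mulrA.
  by rewrite (le_trans (@mulmx_coord_bound _ _ _ C z c t j Cc zt)) // mulrA.
have h2 : `|(C *m (v + z)) j 0| <= p%:R * (c * (B + 1)).
  apply: mulmx_coord_bound => // k; rewrite mxE (le_trans (ler_normD _ _)) //.
  by rewrite lerD // (le_trans (zt k)).
split.
  by apply: (le_trans h1); rewrite ler_wpM2r //; lra.
have -> : (v + z) j 0 * (C *m (v + z)) j 0 - v j 0 * (D *m v) j 0 =
    v j 0 * ((C *m (v + z)) j 0 - (D *m v) j 0) + z j 0 * (C *m (v + z)) j 0.
  by rewrite [(v + z) j 0]mxE; ring.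
rewrite (le_trans (ler_normD _ _)) // !normrM.
apply: (@le_trans _ _ (B * (L1 * t) + t * (p%:R * (c * (B + 1))))).
  by rewrite lerD // ler_pM.
have -> : B * (L1 * t) + t * (p%:R * (c * (B + 1))) = L2 * t.
  by rewrite /L2; ring.
by rewrite ler_wpM2r //; lra.
Qed.

(** The part of the box outside [O] is compact, and the total violation [h] of the constraints is
    continuous and positive there, because its zeros lie in [Mset]. Its minimum yields the margin
    [e]. *)
Lemma Mset_nbhd (R : realType) (p : nat) (C : 'M[R]_p) (m : 'I_p -> R)
    (psi : 'I_p -> \bar R) (O : set 'cV[R]_p) (B : R) :
  @open 'cV[R]_p O -> Mset C m psi `<=` O ->
  exists2 e : R, 0 < e & forall u : 'cV[R]_p, (forall j, `|u j 0| <= B) ->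
    (forall j, psi j = +oo%E -> `|(C *m u) j 0| <= e) ->
    (forall j, (psi j < +oo)%E -> u j 0 * (C *m u) j 0 <= m j + e) -> O u.
Proof.
move=> Oo MO.
(* [|x| + x] is twice the positive part of [x]: a continuous measure of how far the inequality
   fails. *)
pose viol j (u : 'cV[R]_p) := if psi j == +oo%E then `|(C *m u) j 0| else
  `|u j 0 * (C *m u) j 0 - m j| + (u j 0 * (C *m u) j 0 - m j).
have viol0 j u : 0 <= viol j u.
  rewrite /viol; case: ifP => // _; move: (_ - m j) => x.
  by have := ler_norm (- x); rewrite normrN; lra.
pose h u := \sum_j viol j u.
have hc : continuous h.
  apply: continuous_sumr => j; rewrite /viol; case: (psi j == +oo%E) => u.
    apply: (@continuous_comp _ _ _ (fun u : 'cV[R]_p => (C *m u) j 0)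
      (fun x => `|x|)); first exact: mulmx_coord_continuous.
    exact: norm_continuous.
  apply: (@continuous_comp _ _ _ (fun u : 'cV[R]_p =>
      u j 0 * (C *m u) j 0 - m j) (fun x : R => `|x| + x)).
    apply: (@continuousB _ _ _ (fun u : 'cV[R]_p => u j 0 * (C *m u) j 0)
      (fun=> m j)); last exact: cst_continuous.
    apply: (@continuousM _ _ (fun u : 'cV[R]_p => u j 0)
      (fun u : 'cV[R]_p => (C *m u) j 0)); first exact: coord_continuous.
    exact: mulmx_coord_continuous.
  by apply: continuousD; [exact: norm_continuous|exact: cvg_id].
pose K := [set v : 'cV[R]_p | forall j, `|v j 0| <= B] `&` ~` O.
have Kc : compact K.
  apply: (subclosed_compact _ (@cV_box_compact R p B)); last by move=> v [].
  apply: closedI; last exact: open_closedC.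
  by apply: compact_closed (@cV_box_compact R p B); exact: norm_hausdorff.
have [K0|K0] := pselect (K !=set0); last first.
  exists 1 => // u uB _ _; apply: contrapT => nO; apply: K0; exists u.
  by split.
have [c /set_mem[cB cO] cmin] := compact_EVT_min K0 Kc (continuous_subspaceT hc).
have hc0 : 0 < h c.
  rewrite lt_neqAle sumr_ge0 // andbT eq_sym; apply/negP => /eqP hc0.
  apply: cO; apply: MO => j; have := hc0.
  move/eqP; rewrite psumr_eq0 // => /allP/(_ j (mem_index_enum j)) /=.
  rewrite /viol; case: (eqVneq (psi j) +oo%E) => [->|npsi].
    by rewrite normr_eq0 => /eqP Cc0; split=> //; rewrite ltxx.
  move=> /eqP vj; split=> [pj|_]; first by rewrite pj eqxx in npsi.
  by have := normr_ge0 (c j 0 * (C *m c) j 0 - m j); lra.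
(* Under the relaxed constraints each term of [h] is at most [2 * e], and the total [p%:R * (2 * e)]
   stays below [h c = 4 * p.+1%:R * e]. *)
exists (h c / (4 * p.+1%:R)); first by rewrite divr_gt0 // mulr_gt0.
set e := _ / _ => u uB u1 u2.
have e0 : 0 < e by rewrite divr_gt0 // mulr_gt0.
apply: contrapT => nO.
have := cmin u (mem_set (conj uB nO)).
rewrite leNgt => /negP; apply; apply: (@le_lt_trans _ _ (p%:R * (2 * e))).
  rewrite mulr_natl -[X in _ *+ X]card_ord -sumr_const; apply: ler_sum => j _.
  rewrite /viol; case: (eqVneq (psi j) +oo%E) => [/u1|npsi]; first by lra.
  have : (psi j < +oo)%E by rewrite ltey.
  move=> /u2; have [h1|h1] := lerP 0 (u j 0 * (C *m u) j 0 - m j).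
    by rewrite ger0_norm //; lra.
  by rewrite ltr0_norm //; lra.
have -> : h c = 4 * p.+1%:R * e by rewrite /e mulrC divfK // mulf_neq0.
have : p%:R <= p.+1%:R :> R by rewrite ler_nat.
have : 0 < p.+1%:R :> R by [].
move: (p%:R) (p.+1%:R) => x y y0 xy; nra.
Qed.

Section scaled_kkt.
Variables (R : realType) (n p : nat) (X : 'M[R]_(n, p)) (lam : 'I_p -> R).
Hypothesis lam_ge0 : forall j, 0 <= lam j.
Hypothesis X_unit : X^T *m X \in unitmx.

Lemma LSest_shift (beta : 'cV[R]_p) (e : 'cV[R]_n) :
  LSest X (X *m beta + e) = beta + LSest X e.
Proof. by rewrite /LSest mulmxDr mulmxDr mulmxA mulKmx. Qed.

Lemma LSest_normal_eq (y : 'cV[R]_n) : (X^T *m X) *m LSest X y = X^T *m y.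
Proof. by rewrite /LSest mulKVmx. Qed.

Variables (ls : R) (y : 'cV[R]_n) (b : 'cV[R]_p).
Hypothesis ls_gt0 : 0 < ls.
Hypothesis n_gt0 : (0 < n)%N.
Hypothesis b_AL : is_AL X lam y b.

Let r := Num.sqrt (n%:R / ls).
Let v := r *: (b - LSest X y).
Let D := n%:R^-1 *: (X^T *m X).
Let ell j := r * LSest X y j 0.

Let r_gt0 : 0 < r. Proof. by rewrite sqrtr_gt0 divr_gt0 // ltr0n. Qed.

Let r2 : r ^+ 2 / n%:R = ls^-1.
Proof.
rewrite sqr_sqrtr ?divr_ge0 ?ler0n ?(ltW ls_gt0) // mulrAC mulfV ?mul1r //.
by rewrite gt_eqF // ltr0n.
Qed.

(** By the normal equations, [X^T *m (y - X *m b)] is minus [X^T *m X] applied to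
    [b - LSest X y]. *)
Let DvE j : (D *m v) j 0 = - (r / n%:R * (X^T *m (y - X *m b)) j 0).
Proof.
rewrite /D /v -scalemxAl -scalemxAr scalerA mxE mulmxBr LSest_normal_eq.
rewrite -mulmxA mulmxBr [n%:R^-1 * r]mulrC -mulrN; congr (_ * _).
by rewrite !mxE opprB.
Qed.

Lemma scaled_kkt_bound j : `|(D *m v) j 0| * `|ell j| <= lam j / ls.
Proof.
have w0 i : 0 <= lam i / `|LSest X y i 0| by rewrite divr_ge0.
have [kkt _] := pen_obj_kkt w0 j (is_AL_pen_obj b_AL).
rewrite DvE normrN !normrM (gtr0_norm r_gt0) ger0_norm ?invr_ge0 ?ler0n //.
(* If the least squares coordinate is 0, so is [ell j], and the bound is trivial. *)
have [->|L0] := eqVneq (LSest X y j 0) 0.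
  by rewrite normr0 !mulr0 divr_ge0 // ltW.
have L1 : 0 < `|LSest X y j 0| by rewrite normr_gt0.
move: kkt; rewrite ler_pdivlMr // => kkt.
rewrite -r2 mulrC; set x := `|_ j 0| in kkt *; set l := `|_| in kkt *.
have -> : r * l * (r / n%:R * x) = (x * l) * (r ^+ 2 / n%:R) by ring.
by rewrite ler_wpM2r // divr_ge0 ?ler0n // sqr_ge0.
Qed.

(** Complementary slackness with denominators cleared; [ell j + v j 0] is the rescaled estimate
    [r * b j 0]. *)
Lemma scaled_kkt_sign j : LSest X y j 0 != 0 ->
  - ((D *m v) j 0 * (ell j + v j 0) * `|ell j|) = lam j / ls * `|ell j + v j 0|.
Proof.
move=> L0.
have w0 i : 0 <= lam i / `|LSest X y i 0| by rewrite divr_ge0.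
have [_ kkt] := pen_obj_kkt w0 j (is_AL_pen_obj b_AL).
have L1 : 0 < `|LSest X y j 0| by rewrite normr_gt0.
have -> : ell j + v j 0 = r * b j 0 by rewrite /v /ell !mxE; ring.
rewrite DvE !normrM (gtr0_norm r_gt0) -r2.
have {kkt} : (X^T *m (y - X *m b)) j 0 * b j 0 * `|LSest X y j 0| =
    lam j * `|b j 0| by rewrite kkt mulrAC divfK ?gt_eqF.
move: ((X^T *m _) j 0) (b j 0) `|LSest _ _ _ _| `|b j 0| => x bj l ab kkt.
have -> : lam j * (r ^+ 2 / n%:R) * (r * ab) = (lam j * ab) * (r ^+ 3 / n%:R).
  by ring.
by rewrite -kkt; ring.
Qed.

(** Split [v] as [(ell + v) - ell]: the first part has a nonpositive product with the gradient by
    [scaled_kkt_sign], the second contributes at most [lam j / ls] by [scaled_kkt_bound]. *)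
Lemma scaled_kkt_prod j : LSest X y j 0 != 0 ->
  v j 0 * (D *m v) j 0 <= lam j / ls.
Proof.
move=> L0; have := scaled_kkt_sign L0; have := scaled_kkt_bound j.
have l0 : 0 < `|ell j| by rewrite normr_gt0 mulf_neq0 // gt_eqF.
have rho0 : 0 <= lam j / ls * `|ell j + v j 0|.
  by rewrite mulr_ge0 // divr_ge0 // ltW.
have : - (ell j * (D *m v) j 0) <= `|(D *m v) j 0| * `|ell j|.
  by rewrite -normrM [X in _ <= `|X|]mulrC -normrN ler_norm.
move: rho0 l0; move: (ell j) ((D *m v) j 0) (v j 0) (`|ell j + _|) => l g x a.
move: (`|l|) (lam j / ls * a) (`|g|) (lam j / ls) => al s ag rho.
move=> s0 al0 h1 h2 h3; rewrite -(ler_pM2r al0).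
have : (- (l * g)) * al <= rho * al by rewrite ler_pM2r // (le_trans h1 h2).
nra.
Qed.

(** Summing [scaled_kkt_prod] over the coordinates bounds the quadratic form at [v] by [p%:R], since
    every ratio [lam j / ls] is at most 1. *)
Lemma scaled_kkt_bounded k :
  0 < k -> (forall v : 'cV[R]_p, k * sqnorm v <= (v^T *m D *m v) 0 0) ->
  (forall j, lam j <= ls) -> (forall j, LSest X y j 0 != 0) ->
  forall j, `|v j 0| <= Num.sqrt (p%:R / k).
Proof.
move=> k0 kD lamls L0 j; rewrite -sqrtr_sqr ler_wsqrtr //.
rewrite ler_pdivlMr // mulrC; apply: (@le_trans _ _ (k * sqnorm v)).
  by rewrite ler_pM2l // sqr_coord_le_sqnorm.
apply: (le_trans (kD v)); rewrite qformE.
rewrite -[X in X%:R]card_ord -sumr_const; apply: ler_sum => i _.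
by apply: (le_trans (scaled_kkt_prod (L0 i))); rewrite ler_pdivrMr // mul1r.
Qed.

End scaled_kkt.

Lemma prob_exists_le (R : realType) (d : measure_display) (T : measurableType d)
    (P : probability T R) (p : nat) (A : 'I_p -> set T) (e : R) :
  (forall j, measurable (A j)) -> (forall j, (P (A j) <= e%:E)%E) ->
  measurable [set w | exists j, A j w] /\
  (P [set w | exists j, A j w] <= (p%:R * e)%:E)%E.
Proof.
move=> mA PA; have -> : [set w | exists j, A j w] = \big[setU/set0]_(j < p) A j.
  rewrite -bigcup_seq; apply/seteqP; split=> w [j].
    by exists j => //=; rewrite mem_index_enum.
  by move=> _ Ajw; exists j.
split; first exact: bigsetU_measurable.
have -> : ((p%:R * e)%:E = \sum_(j < p) e%:E)%E.
  by rewrite sumEFin sumr_const card_ord mulr_natl.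
elim: (index_enum _) => [|j r ih]; first by rewrite !big_nil measure0.
rewrite !big_cons.
apply: (@le_trans _ _ (P (A j) + P (\big[setU/set0]_(i <- r) A i))%E).
  by apply: measureU2 => //; exact: bigsetU_measurable.
exact: leeD.
Qed.

Lemma cvg_fin_near (R : realType) (f : nat -> \bar R) (l : R) :
  (forall e, 0 < e -> \forall n \near \oo,
     ((l - e)%:E <= f n)%E /\ (f n <= (l + e)%:E)%E) ->
  f @ \oo --> l%:E.
Proof.
move=> h; apply/fine_cvgP; split.
  apply: filterS (h 1 ltr01) => n [h1 h2].
  by rewrite fin_numElt (lt_le_trans _ h1) ?ltNyr // (le_lt_trans h2) ?ltry.
apply/cvgrPdist_le => e /h; apply: filterS => n /=.
case: (f n) => [x| |] /= [].
- by rewrite !lee_fin ler_norml => h1 h2; apply/andP; split; lra.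
- by rewrite leye_eq.
- by rewrite leeNy_eq.
Qed.

(* With [l ^+ 2 = a / q] for some [dd < q < 1], the penalty is too weak to
   shrink the coordinate to zero, so that [g] is close to [- l^-1] and
   [v * g] close to [a / l ^+ 2 = q]. *)
Lemma kkt_above_boundary (R : realType) (a dd L1 L2 : R) :
  0 < a -> 0 < dd < 1 -> 0 <= L1 -> 0 <= L2 ->
  exists l t : R, [/\ 0 < l, 0 < t <= 1, t <= l / 2 &
  forall ell g v rho, `|ell - l| <= t -> 1 - t <= rho <= 1 ->
    `|g| * `|ell| <= rho -> - (g * (ell + v) * `|ell|) = rho * `|ell + v| ->
    `|v - a * g| <= L2 * t -> dd < v * g - L1 * t].
Proof.
move=> a0 /andP[dd0 dd1] L10 L20.
pose q := (1 + dd) / 2; have q1 : q < 1 by rewrite /q; lra.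
have qdd : dd < q by rewrite /q; lra.
have q0 : 0 < q by apply: lt_trans qdd.
pose l := Num.sqrt (a / q); have l0 : 0 < l by rewrite sqrtr_gt0 divr_gt0.
have l2 : q * l ^+ 2 = a.
  by rewrite sqr_sqrtr ?(ltW (divr_gt0 a0 q0)) // mulrCA mulfV ?mulr1 // gt_eqF.
have l2a : a < l ^+ 2 by rewrite -l2 gtr_pMl // exprn_gt0.
have l2d : dd * l ^+ 2 < a by rewrite -l2 ltr_pM2r // exprn_gt0.
(* [k] majorises the coefficients of [t] in the error terms below, so that [t * k < m] fits them
   into both gaps, [l ^+ 2 - a] and [a - dd * l ^+ 2]. *)
pose k := 1 + 2 * a + 2 * l * L2 + 3 * l + 4 * L1 * l ^+ 2.
have L2l : 0 <= L2 * l by rewrite mulr_ge0 // ltW.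
have L1l : 0 <= L1 * l ^+ 2 by rewrite mulr_ge0 // ltW // exprn_gt0.
have k1 : 1 <= k by rewrite /k; lra.
pose m := Num.min (Num.min 1 (l / 2)) (Num.min (l ^+ 2 - a) (a - dd * l ^+ 2)).
have m0 : 0 < m by rewrite !lt_min ltr01 divr_gt0 //= !subr_gt0 l2a l2d.
have : m <= m by []; rewrite {2}/m !le_min => /andP[/andP[m1 m2] /andP[m3 m4]].
pose t := m / (2 * k); have t0 : 0 < t by rewrite divr_gt0 // mulr_gt0 //; lra.
have tk : t * k < m.
  have -> : t * k = m / 2 by rewrite /t; field; lra.
  lra.
have tm : t <= m by apply: le_trans (ltW tk); rewrite ler_peMr // ltW.
exists l, t; split => //; [by rewrite t0 (le_trans tm)|by rewrite (le_trans tm)|].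
move=> ell g v rho; rewrite ler_distl => /andP[e1 e2] /andP[r1 r2] gl.
have tl : t <= l / 2 by rewrite (le_trans tm).
have ell0 : 0 < ell by lra.
rewrite (gtr0_norm ell0) in gl *; move=> kkt; rewrite ler_distl => /andP[v1 v2].
have gl1 : - rho <= g * ell.
  have : `|g * ell| <= rho by rewrite normrM (gtr0_norm ell0).
  by rewrite ler_norml => /andP[].
have ell_hi : ell ^+ 2 <= l ^+ 2 + 3 * l * t.
  have : ell ^+ 2 <= (l + t) ^+ 2 by rewrite lerXn2r ?nnegrE //; lra.
  have : t * t <= l * t by rewrite ler_pM2r //; lra.
  rewrite !expr2; lra.
have ell_lo : l ^+ 2 - 2 * l * t <= ell ^+ 2.
  have : (l - t) ^+ 2 <= ell ^+ 2 by rewrite lerXn2r ?nnegrE //; lra.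
  have := sqr_ge0 t; rewrite !expr2; lra.
have L2t : 0 <= L2 * t by rewrite mulr_ge0 // ltW.
have L2te : L2 * t * ell <= 2 * l * (L2 * t).
  by rewrite mulrC ler_wpM2r //; lra.
move: tk; rewrite /k => tk.
have at0 : 0 <= a * t by rewrite mulr_ge0 // ltW.
have lt0 : 0 <= l * t by rewrite mulr_ge0 // ltW.
have L1lt : 0 <= L1 * l ^+ 2 * t by rewrite mulr_ge0 // ltW.
(* Multiplied by [ell], the sum is at least [l ^+ 2 - a] up to errors of order [t]. So the
   coordinate is not shrunk to zero, and the sign condition becomes [g * ell = - rho]. *)
have pos : 0 < ell + v.
  rewrite -(pmulr_rgt0 _ ell0).
  have : (a * g - L2 * t) * ell <= v * ell by rewrite ler_pM2r //; lra.
  have : - a <= a * (g * ell).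
    by rewrite -[leLHS]mulr1 mulNr -mulrN ler_pM2l //; lra.
  rewrite expr2 in ell_lo; nra.
have gE : g * ell = - rho.
  apply: (mulIf (lt0r_neq0 pos)); move: kkt; rewrite (gtr0_norm pos) => kkt; lra.
rewrite ltNge; apply/negP => hle.
(* The main term is [a * rho ^+ 2], close to [a]; the other is of order [t]. A product of at most
   [dd + L1 * t] would put [a] below [dd * l ^+ 2] up to order [t]. *)
have vg : v * g * ell ^+ 2 = a * (g * ell) ^+ 2 + (v - a * g) * (g * ell) * ell.
  by ring.
have rho0 : 0 <= rho by lra.
have vg_lo : a * (1 - 2 * t) - 2 * l * (L2 * t) <= v * g * ell ^+ 2.
  have rho2 : (1 - t) ^+ 2 <= rho ^+ 2 by rewrite lerXn2r ?nnegrE //; lra.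
  have : a * (1 - 2 * t) <= a * rho ^+ 2.
    by rewrite ler_pM2l //; have := sqr_ge0 t; move: rho2; rewrite !expr2; lra.
  have : (v - a * g) * (rho * ell) <= L2 * t * ell.
    apply: (@le_trans _ _ (L2 * t * (rho * ell))).
      by rewrite ler_wpM2r ?mulr_ge0 ?(ltW ell0) //; lra.
    by rewrite ler_wpM2l // ler_piMl // ltW.
  rewrite vg gE sqrrN mulrN mulNr -mulrA; lra.
have : v * g * ell ^+ 2 <= (dd + L1 * t) * (l ^+ 2 + 3 * l * t).
  apply: (@le_trans _ _ ((dd + L1 * t) * ell ^+ 2)).
    by rewrite ler_pM2r ?exprn_gt0 //; lra.
  have c0 : 0 <= dd + L1 * t.
    by apply: addr_ge0; [exact: ltW|rewrite mulr_ge0 // ltW].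
  exact: ler_wpM2l.
have : L1 * t * (l ^+ 2 + 3 * l * t) <= L1 * t * (4 * l ^+ 2).
  have L1t : 0 <= L1 * t by rewrite mulr_ge0 // ltW.
  apply: ler_wpM2l => //; rewrite expr2.
  have : l * t <= l * l by rewrite ler_pM2l //; lra.
  lra.
have : dd * (l * t) <= l * t by rewrite ler_piMl // ltW.
lra.
Qed.

(** * Coverage probabilities *)

(** The diagonal entry is the value of the form of [C] at column [j] of [invmx C]. *)
Lemma invmx_diag_gt0 (R : realType) (p : nat) (C : 'M[R]_p) (j : 'I_p) :
  (forall v : 'cV[R]_p, v != 0 -> 0 < (v^T *m C *m v) 0 0) ->
  0 < invmx C j j.
Proof.
move=> Cpd; have [k k0 kC] := qform_lower_bound Cpd.
have Cu := qform_unitmx k0 kC.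
pose x := invmx C *m delta_mx j (0 : 'I_1).
have xE i : x i 0 = invmx C i j.
  rewrite mxE (bigD1 j) //= big1 ?addr0 ?mxE ?eqxx ?mulr1 // => l /negbTE lj.
  by rewrite mxE lj mulr0.
have Cx : C *m x = delta_mx j 0 by rewrite mulKVmx.
have x0 : x != 0.
  apply/eqP => x0; have := congr1 (fun v : 'cV[R]_p => v j 0) Cx.
  by rewrite x0 mulmx0 !mxE !eqxx => /eqP; rewrite eq_sym oner_eq0.
have := Cpd x x0; rewrite qformE (bigD1 j) //= big1 ?addr0 => [|i /negbTE ij].
  by rewrite Cx xE mxE !eqxx mulr1.
by rewrite Cx [delta_mx _ _ _ _]mxE ij mulr0.
Qed.

(** Closedness makes the coverage event of this set measurable, so that its probability can be
    compared by monotonicity. *)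
Lemma Mset_closed (R : realType) (p : nat) (C : 'M[R]_p) (m : 'I_p -> R)
    (psi : 'I_p -> \bar R) :
  @closed 'cV[R]_p (Mset C m psi).
Proof.
have -> : Mset C m psi = \bigcap_j [set u : 'cV[R]_p |
    (psi j = +oo%E -> (C *m u) j 0 = 0) /\
    ((psi j < +oo)%E -> u j 0 * (C *m u) j 0 <= m j)].
  by apply/seteqP; split=> u /= h j; [move=> _|]; exact: h.
apply: closed_bigI => j _.
have [pj|pj] := eqVneq (psi j) +oo%E.
  rewrite (_ : [set u | _] = (fun u : 'cV[R]_p => (C *m u) j 0) @^-1` [set 0]).
    apply: closed_comp; last exact: closed_eq.
    by move=> u _; exact: mulmx_coord_continuous.
  apply/seteqP; split=> u /=; first by case=> h _; exact: h.
  by move=> h; split=> // ; rewrite pj ltxx.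
rewrite (_ : [set u | _] = (fun u : 'cV[R]_p => u j 0 * (C *m u) j 0) @^-1`
    [set x | x <= m j]).
  apply: closed_comp; last exact: closed_le.
  move=> u _; apply: (@continuousM _ _ (fun u : 'cV[R]_p => u j 0)
    (fun u : 'cV[R]_p => (C *m u) j 0)); first exact: coord_continuous.
  exact: mulmx_coord_continuous.
apply/seteqP; split=> u /=; first by case=> _; apply; rewrite ltey.
by move=> h; split=> // /eqP; rewrite (negbTE pj).
Qed.

Section adaptive_lasso.
Variables (R : realType) (d : measure_display) (T : measurableType d).
Variables (P : probability T R) (p : nat).
Variables (X : forall n : nat, 'M[R]_(n, p)) (eps : forall n : nat, 'I_n -> T -> R).
Arguments eps : clear implicits.
Variables (C : 'M[R]_p) (lam : nat -> 'I_p -> R).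
Hypothesis lam_ge0 : forall n j, 0 <= lam n j.
Hypothesis eps_meas : forall n (i : 'I_n), measurable_fun setT (eps n i).

Local Notation ls n := (lamstar (lam n)).
Local Notation W n w := (Num.sqrt n%:R *: LSest (X n) (epsvec (eps n) w)).
Local Notation D n := (n%:R^-1 *: ((X n)^T *m X n)).
Local Notation scale n := (Num.sqrt (ls n / n%:R)).

(** What the finite-sample arguments require; it holds for all large [n] with one common [k]. *)
Definition regular (k : R) (n : nat) := [/\ (0 < n)%N, 0 < ls n &
  forall v : 'cV[R]_p, k * sqnorm v <= (v^T *m D n *m v) 0 0].

Lemma lam_le_lamstar n j : lam n j <= ls n.
Proof. exact: le_bigmax. Qed.

Lemma W_coord_measurable n j : measurable_fun setT (fun w => W n w j 0).
Proof.
under eq_fun do rewrite mxE; apply: measurable_funM; first exact: measurable_cst.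
apply: LSest_measurable => i; under eq_fun do rewrite mxE; exact: eps_meas.
Qed.

(** * Coverage events at a fixed sample size *)

Section regular_design.
Variables (k : R) (n : nat).
Hypotheses (k0 : 0 < k) (reg : regular k n).

Let n0 : (0 < n)%N. Proof. by case: reg. Qed.
Let nR0 : 0 < n%:R :> R. Proof. by rewrite ltr0n. Qed.
Let ls0 : 0 < ls n. Proof. by case: reg. Qed.

Lemma gram_lower (v : 'cV[R]_p) :
  n%:R * k * sqnorm v <= (v^T *m ((X n)^T *m X n) *m v) 0 0.
Proof.
case: reg => _ _ /(_ v); rewrite -scalemxAr -scalemxAl mxE.
by rewrite ler_pdivlMl // mulrA.
Qed.

Lemma gram_unit : (X n)^T *m X n \in unitmx.
Proof. by apply: qform_unitmx (mulr_gt0 nR0 k0) _; exact: gram_lower. Qed.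

Lemma design_lower (v : 'cV[R]_p) :
  n%:R * k * sqnorm v <= sqnorm (X n *m v).
Proof. by rewrite [leRHS]sqnormE trmx_mul !mulmxA -[_ *m X n]mulmxA gram_lower. Qed.

Lemma scale_gt0 : 0 < scale n.
Proof. by rewrite sqrtr_gt0 divr_gt0. Qed.

Lemma scaleV : (scale n)^-1 = Num.sqrt (n%:R / ls n).
Proof. by rewrite -sqrtrV ?divr_ge0 ?ler0n ?(ltW ls0) // invf_div. Qed.

Lemma scaleVE : (scale n)^-1 * (Num.sqrt n%:R)^-1 = (Num.sqrt (ls n))^-1.
Proof.
rewrite scaleV sqrtrM ?ler0n // sqrtrV ?(ltW ls0) // mulrAC divff ?mul1r //.
by rewrite gt_eqF // sqrtr_gt0.
Qed.

Lemma LSest_W (beta : 'cV[R]_p) w :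
  LSest (X n) (X n *m beta + epsvec (eps n) w) =
  beta + (Num.sqrt n%:R)^-1 *: W n w.
Proof.
rewrite LSest_shift; last exact: gram_unit.
by rewrite scalerA mulVf ?scale1r // gt_eqF // sqrtr_gt0.
Qed.

Lemma cover_eventE (beta : 'cV[R]_p) (S : set 'cV[R]_p) :
  cover_event (X n) (lam n) (eps n) beta (scale n) S =
  [set w | exists2 b, is_AL (X n) (lam n) (X n *m beta + epsvec (eps n) w) b
                    & S ((scale n)^-1 *: (b - beta))].
Proof.
have s0 : scale n != 0 by rewrite gt_eqF // scale_gt0.
apply/seteqP; split=> w [b].
  move=> [hb [s [Ss betaE]]]; exists b => //.
  by rewrite betaE opprB addrC subrK scalerA mulVf // scale1r.
move=> hb Ss; exists b; split=> //; exists ((scale n)^-1 *: (b - beta)).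
by split=> //; rewrite scalerA mulfV // scale1r opprB addrC subrK.
Qed.

Lemma cover_event_closed_measurable (beta : 'cV[R]_p) (S : set 'cV[R]_p) :
  closed S ->
  measurable (cover_event (X n) (lam n) (eps n) beta (scale n) S).
Proof.
move=> Scl; rewrite cover_eventE.
apply: (@AL_event_closed_measurable _ _ _ _ _ _ _
  (fun w => X n *m beta + epsvec (eps n) w) _ _ _ (mulr_gt0 nR0 k0)
  design_lower (fun b => S ((scale n)^-1 *: (b - beta)))) => //.
  move=> i; under eq_fun do rewrite mxE.
  apply: measurable_funD; first exact: measurable_cst.
  by under eq_fun do rewrite mxE; exact: eps_meas.
apply: (@closed_comp _ _ (fun b : 'cV[R]_p => (scale n)^-1 *: (b - beta))) => //.
move=> b _; apply: (@continuous_comp _ _ _ (fun b : 'cV[R]_p => b - beta)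
  (fun b : 'cV[R]_p => (scale n)^-1 *: b)); last exact: scaler_continuous.
by apply: continuousB; [exact: cvg_id|exact: cst_continuous].
Qed.

(** The minimiser exists and is unique, so failing to cover with [S] is covering with its closed
    complement. *)
Lemma cover_event_open_measurable (beta : 'cV[R]_p) (S : set 'cV[R]_p) :
  @open 'cV[R]_p S ->
  measurable (cover_event (X n) (lam n) (eps n) beta (scale n) S).
Proof.
move=> So; rewrite -[X in measurable X]setCK; apply: measurableC.
have -> : ~` cover_event (X n) (lam n) (eps n) beta (scale n) S =
    cover_event (X n) (lam n) (eps n) beta (scale n) (~` S).
  rewrite !cover_eventE; apply/seteqP; split=> w /=.
    move=> h; have [b hb] := is_AL_exists (fun w => X n *m beta + epsvec (eps n) w)
      (lam_ge0 n) (mulr_gt0 nR0 k0) design_lower w.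
    by exists b => // Sb; apply: h; exists b.
  move=> [b hb nS] [b' hb' Sb']; apply: nS.
  by rewrite (is_AL_uniq (y := fun w => X n *m beta + epsvec (eps n) w)
      (lam_ge0 n) (mulr_gt0 nR0 k0) design_lower hb hb').
by apply: cover_event_closed_measurable; exact: open_closedC.
Qed.

Lemma rescaled_deviation (beta b : 'cV[R]_p) w :
  (scale n)^-1 *: (b - beta) =
  Num.sqrt (n%:R / ls n) *:
    (b - LSest (X n) (X n *m beta + epsvec (eps n) w)) +
  (Num.sqrt (ls n))^-1 *: W n w.
Proof.
rewrite LSest_W -scaleV -scaleVE -scalerA -scalerDr; congr (_ *: _).
by rewrite opprD addrA subrK.
Qed.

Lemma rescaled_LSest (beta : 'cV[R]_p) w j :
  Num.sqrt (n%:R / ls n) *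
    LSest (X n) (X n *m beta + epsvec (eps n) w) j 0 =
  (scale n)^-1 * beta j 0 + (Num.sqrt (ls n))^-1 * W n w j 0.
Proof.
rewrite LSest_W -scaleV -scaleVE; move: (W n w) => x.
by rewrite !mxE mulrDr mulrA.
Qed.

(** This form isolates the shift [Num.sqrt n%:R * beta j 0] of [W], to which anti-concentration is
    applied. *)
Lemma rescaled_LSestE (beta : 'cV[R]_p) w j :
  Num.sqrt (n%:R / ls n) *
    LSest (X n) (X n *m beta + epsvec (eps n) w) j 0 =
  (Num.sqrt (ls n))^-1 * (Num.sqrt n%:R * beta j 0 + W n w j 0).
Proof.
rewrite rescaled_LSest mulrDr -scaleVE; congr (_ + _).
by rewrite mulrA divfK // gt_eqF // sqrtr_gt0.
Qed.

End regular_design.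

(** * Noise bounds for large samples *)

Hypothesis D_cvg : (fun n => D n) @ \oo --> C.
Hypothesis C_pd : forall v : 'cV[R]_p, v != 0 -> 0 < (v^T *m C *m v) 0 0.
Hypothesis ls_cvg : forall M : R, \forall n \near \oo, M < ls n.

Lemma regular_near : exists2 k : R, 0 < k & \forall n \near \oo, regular k n.
Proof.
have [k k0 kD] := qform_lower_bound_near D_cvg C_pd; exists k => //.
near=> n; split.
- by near: n; exact: nbhs_infty_gt.
- by near: n; exact: ls_cvg.
- by near: n; exact: kD.
Unshelve. all: by end_near. Qed.

Hypothesis W_tight : forall j (e : R), 0 < e ->
  exists2 K : R, 0 < K &
    \forall n \near \oo, (P [set w | K < `|W n w j 0|]%R <= e%:E)%E.
Hypothesis W_anticonc : forall j (e : R), 0 < e ->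
  exists2 eta : R, 0 < eta & \forall n \near \oo, forall a : R,
    (P [set w | `|a + W n w j 0| < eta]%R <= e%:E)%E.

(** Union bound from [W_tight]: the threshold [t * Num.sqrt (ls n)] eventually exceeds any fixed
    [K]. *)
Lemma W_large_prob (t e : R) : 0 < t -> 0 < e -> \forall n \near \oo,
  measurable [set w | exists j, t * Num.sqrt (ls n) < `|W n w j 0|] /\
  (P [set w | exists j, t * Num.sqrt (ls n) < `|W n w j 0|]%R <= e%:E)%E.
Proof.
move=> t0 e0; have e1 : 0 < e / p.+1%:R by rewrite divr_gt0.
have mA n (K : R) j : measurable [set w | K < `|W n w j 0|].
  have ma : measurable_fun setT (fun w => `|W n w j 0|).
    by apply: measurableT_comp => //; exact: W_coord_measurable.
  have := measurable_fun_ltr (measurable_cst K) ma.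
  by move=> /(_ measurableT [set true] Logic.I); rewrite setTI.
have small j : \forall n \near \oo,
    (P [set w | t * Num.sqrt (ls n) < `|W n w j 0|]%R <= (e / p.+1%:R)%:E)%E.
  have [K K0 HK] := W_tight j e1; near=> n.
  apply: (@le_trans _ _ (P [set w | K < `|W n w j 0|]%R)).
    apply: le_measure; rewrite ?inE //.
    move=> w /=; apply: le_lt_trans.
    have : (K / t) ^+ 2 < ls n by near: n; exact: ls_cvg.
    have Kt : 0 <= K / t by rewrite divr_ge0 ?(ltW K0) ?(ltW t0).
    move=> h; rewrite mulrC -ler_pdivrMr // -(ger0_norm Kt) -sqrtr_sqr.
    by rewrite ler_wsqrtr // ltW.
  by near: n; exact: HK.
have all_small : \forall n \near \oo, forall j,
    (P [set w | t * Num.sqrt (ls n) < `|W n w j 0|]%R <= (e / p.+1%:R)%:E)%E.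
  exact: filter_forall.
apply: filterS all_small => n hn.
have [mE hP] := prob_exists_le (fun j => mA n (t * Num.sqrt (ls n)) j) hn.
split; [exact: mE|apply: (le_trans hP)]; rewrite lee_fin mulrCA ler_piMr ?(ltW e0) //.
by rewrite ler_pdivrMr // mul1r ler_nat.
Unshelve. all: by end_near. Qed.

(** [eta] is the minimum of the coordinatewise values, and the threshold for [n] does not depend on
    [a], which later carries the true parameter. *)
Lemma W_small_prob (e : R) : 0 < e -> exists2 eta : R, 0 < eta &
  \forall n \near \oo, forall a : 'I_p -> R,
  measurable [set w | exists j, `|a j + W n w j 0| < eta] /\
  (P [set w | exists j, `|a j + W n w j 0| < eta]%R <= e%:E)%E.
Proof.
move=> e0; have e1 : 0 < e / p.+1%:R by rewrite divr_gt0.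
have /choice[et het] : forall j, exists eta : R, 0 < eta /\
    \forall n \near \oo, forall a : R,
      (P [set w | `|a + W n w j 0| < eta]%R <= (e / p.+1%:R)%:E)%E.
  by move=> j; have [eta ? ?] := W_anticonc j e1; exists eta.
pose eta := \big[Num.min/1]_j et j.
have eta_le j : eta <= et j by exact: bigmin_le_cond.
exists eta; first by apply/bigmin_gtP; split=> // j _; have [] := het j.
have mA n (a h : R) j : measurable [set w | `|a + W n w j 0| < h].
  have ma : measurable_fun setT (fun w => `|a + W n w j 0|).
    apply: measurableT_comp => //; apply: measurable_funD.
      exact: measurable_cst.
    exact: W_coord_measurable.
  have := measurable_fun_ltr ma (measurable_cst h).
  by move=> /(_ measurableT [set true] Logic.I); rewrite setTI.
have all_small : \forall n \near \oo, forall j (a : R),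
    (P [set w | `|a + W n w j 0| < et j]%R <= (e / p.+1%:R)%:E)%E.
  by apply: filter_forall => j; have [] := het j.
apply: filterS all_small => n hn a.
have hna j : (P [set w | `|a j + W n w j 0| < eta]%R <= (e / p.+1%:R)%:E)%E.
  apply: le_trans (hn j (a j)); apply: le_measure; rewrite ?inE //.
  by move=> w /= h; exact: lt_le_trans h (eta_le j).
have [mE hP] := prob_exists_le (fun j => mA n (a j) eta j) hna.
split; [exact: mE|apply: (le_trans hP)]; rewrite lee_fin mulrCA ler_piMr ?(ltW e0) //.
by rewrite ler_pdivrMr // mul1r ler_nat.
Qed.

(** * Uniform coverage bounds *)

Variables (lam0 : 'I_p -> R) (psi : 'I_p -> \bar R).
Hypothesis lam0_cvg : forall j, (fun n => lam n j / ls n) @ \oo --> lam0 j.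
Hypothesis psi_cvg : forall j, (fun n => psi_ratio (lam n) j) @ \oo --> psi j.

(** The quotient is the reciprocal of [psi_ratio], except when [lam n j = 0], where that ratio is
    infinite by convention and the quotient vanishes. *)
Lemma lam_small j (e : R) : psi j = +oo%E -> 0 < e ->
  \forall n \near \oo, lam n j / Num.sqrt (ls n) <= e.
Proof.
move=> psij e0; have := @psi_cvg j; rewrite psij => /cvgey_gt/(_ e^-1).
apply: filterS => n; rewrite /psi_ratio; case: eqVneq => [->|lamj].
  by rewrite mul0r ltW.
have l0 : 0 < lam n j by rewrite lt_neqAle eq_sym lamj lam_ge0.
rewrite lte_fin ltr_pdivlMr // => h.
have s0 : 0 < Num.sqrt (ls n) by apply: lt_trans h; rewrite mulr_gt0 ?invr_gt0.
by rewrite ler_pdivrMr // -ler_pdivrMl // ltW.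
Qed.

(** Coverage is certain outside two events: a large noise term, and some least squares coordinate
    close to zero. Each has probability at most [e / 2], whatever [beta] is. *)
Lemma cover_lower (O : set 'cV[R]_p) (e : R) :
  @open 'cV[R]_p O -> Mset C lam0 psi `<=` O -> 0 < e ->
  \forall n \near \oo, forall beta,
  ((1 - e)%:E <= P (cover_event (X n) (lam n) (eps n) beta (scale n) O))%E.
Proof.
move=> Oo MO e0; have [k k0 reg] := regular_near.
pose B := Num.sqrt (p%:R / k); have B0 : 0 <= B by exact: sqrtr_ge0.
have [L L0 pert] := mulmx_qform_perturb C B0.
have [de de0 nb] := Mset_nbhd (B + 1) Oo MO.
(* Passing from [D n] and [v] to [C] and [v + z] costs at most [L * t], half of the margin [de]; the
   other half absorbs the errors of the tuning parameters. *)
pose t := Num.min 1 (de / (2 * L)).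
have t0 : 0 < t by rewrite lt_min ltr01 divr_gt0 // mulr_gt0.
have t1 : t <= 1 by rewrite ge_min lexx.
have Lt : L * t <= de / 2.
  rewrite (@le_trans _ _ (L * (de / (2 * L)))) //.
    by rewrite ler_pM2l // ge_min lexx orbT.
  by rewrite le_eqVlt; apply/orP; left; apply/eqP; field; rewrite gt_eqF.
have e20 : 0 < e / 2 by rewrite divr_gt0.
have de20 : 0 < de / 2 by rewrite divr_gt0.
have [eta eta0 Wsmall] := W_small_prob e20.
have lams : \forall n \near \oo, forall j, psi j = +oo%E ->
    lam n j / Num.sqrt (ls n) <= de / 2 * eta.
  apply: filter_forall => j.
  have [pj|pj] := pselect (psi j = +oo%E); last by apply: nearW => n /pj.
  have := lam_small pj (mulr_gt0 de20 eta0); apply: filterS => n hn _.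
  exact: hn.
have rhos : \forall n \near \oo, forall j, lam n j / ls n <= lam0 j + de / 2.
  apply: filter_forall => j.
  have := cvgr_lt _ (@lam0_cvg j) (lam0 j + de / 2).
  by rewrite ltrDl => /(_ _ de20); apply: filterS => n /ltW.
near=> n.
have rn : regular k n by near: n.
have [mE1 PE1] : measurable [set w | exists j,
      t * Num.sqrt (ls n) < `|W n w j 0|] /\
    (P [set w | exists j, t * Num.sqrt (ls n) < `|W n w j 0|]%R <= (e / 2)%:E)%E.
  by near: n; exact: W_large_prob.
have Dn i j : `|D n i j - C i j| <= t.
  apply: ltW; move: i j; near: n; exact: cvg_mx_coord_near.
have lamn : forall j, psi j = +oo%E ->
    lam n j / Num.sqrt (ls n) <= de / 2 * eta by near: n.
have rhon : forall j, lam n j / ls n <= lam0 j + de / 2 by near: n.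
have Wn : forall a : 'I_p -> R,
    measurable [set w | exists j, `|a j + W n w j 0| < eta] /\
    (P [set w | exists j, `|a j + W n w j 0| < eta]%R <= (e / 2)%:E)%E.
  by near: n.
move=> beta; have [mE2 PE2] := Wn (fun j => Num.sqrt n%:R * beta j 0).
have [n0 ls0 Dk] := rn.
have sl0 : 0 < Num.sqrt (ls n) by rewrite sqrtr_gt0.
have nR0 : 0 < n%:R :> R by rewrite ltr0n.
set E1 := [set w | _] in mE1 PE1; set E2 := [set w | _] in mE2 PE2.
have sub : ~` (E1 `|` E2) `<=`
    cover_event (X n) (lam n) (eps n) beta (scale n) O.
  move=> w; rewrite setCU => -[nE1 nE2].
  have W1 j : `|(Num.sqrt (ls n))^-1 * W n w j 0| <= t.
    rewrite normrM normfV (gtr0_norm sl0) ler_pdivrMl // mulrC leNgt.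
    by apply/negP => h; apply: nE1; exists j.
  have W2 j : eta <= `|Num.sqrt n%:R * beta j 0 + W n w j 0|.
    by rewrite leNgt; apply/negP => h; apply: nE2; exists j.
  pose y := X n *m beta + epsvec (eps n) w.
  have ell_ge j : eta / Num.sqrt (ls n) <=
      `|Num.sqrt (n%:R / ls n) * LSest (X n) y j 0|.
    rewrite (rescaled_LSestE k0 rn) normrM normfV (gtr0_norm sl0) mulrC.
    by rewrite ler_pM2l ?invr_gt0.
  have LS0 j : LSest (X n) y j 0 != 0.
    apply/eqP => LS0; have := ell_ge j; rewrite LS0 mulr0 normr0 leNgt.
    by rewrite divr_gt0.
  have [b hb] := is_AL_exists (fun w => X n *m beta + epsvec (eps n) w)
    (lam_ge0 n) (mulr_gt0 nR0 k0) (design_lower rn) w.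
  rewrite (cover_eventE rn); exists b => //.
  rewrite (rescaled_deviation k0 rn _ _ w) -/y.
  have Gu := gram_unit k0 rn.
  have vB := scaled_kkt_bounded (lam_ge0 n) Gu ls0 n0 hb k0 Dk
    (lam_le_lamstar n) LS0.
  have kb := scaled_kkt_bound (lam_ge0 n) Gu ls0 n0 hb.
  have kp := fun j => scaled_kkt_prod (lam_ge0 n) Gu ls0 n0 hb (LS0 j).
  move: vB kb kp; rewrite -/y; set v := _ *: (b - _) => vB kb kp.
  set z := _ *: W n w.
  have zt j : `|z j 0| <= t by rewrite mxE.
  have pe := pert (D n) v z t _ Dn vB zt.
  have {}pe j := pe (introT andP (conj (ltW t0) t1)) j.
  apply: nb.
  - move=> j; rewrite mxE (le_trans (ler_normD _ _)) // lerD //.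
    by rewrite (le_trans (zt j)).
  - move=> j pj; have [p1 _] := pe j.
    (* Since [|ell j|] is at least [eta / Num.sqrt (ls n)], the subgradient bound gives
       [|g| * eta <= lam n j / Num.sqrt (ls n)] for the gradient entry [g], and [lamn] applies. *)
    have g_le : `|(D n *m v) j 0| <= de / 2.
      rewrite -(ler_pM2r eta0) (le_trans _ (lamn j pj)) //.
      have := le_trans (ler_wpM2l (normr_ge0 _) (ell_ge j)) (kb j).
      rewrite -[X in _ <= _ / X](sqr_sqrtr (ltW ls0)) !ler_pdivlMr ?exprn_gt0 //.
      apply: le_trans; rewrite le_eqVlt; apply/orP; left; apply/eqP.
      by field; rewrite gt_eqF.
    rewrite -[X in `|X|](subrK ((D n *m v) j 0)).
    by rewrite (le_trans (ler_normD _ _)) //; lra.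
  - move=> j pj; have [_ /ler_normlP[_ p2]] := pe j.
    have := kp j; have := rhon j; lra.
have PE : (P (E1 `|` E2) <= e%:E)%E.
  apply: (@le_trans _ _ (P E1 + P E2)%E); first exact: measureU2.
  by rewrite [e in X in (_ <= X)%E]splitr EFinD leeD.
apply: (@le_trans _ _ (P (~` (E1 `|` E2)))).
  rewrite probability_setC; last exact: measurableU.
  by rewrite EFinB leeB.
apply: le_measure; rewrite ?inE //.
  by apply: measurableC; exact: measurableU.
exact: (cover_event_open_measurable k0 rn).
Unshelve. all: by end_near. Qed.

Hypothesis lam0_le1 : forall j, lam0 j <= 1.

(** Otherwise every [lam n j] would eventually lie below [ls n], which is positive, so the maximum
    (started at 0) would lie below itself. *)
Lemma lam0_eq1_exists : exists j, lam0 j = 1.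
Proof.
apply: contrapT => /forallNP h.
have lt1 j : lam0 j < 1 by rewrite lt_neqAle lam0_le1 andbT; apply/eqP.
have rhos : \forall n \near \oo, forall j, lam n j / ls n < 1.
  by apply: filter_forall => j; exact: (cvgr_lt _ (@lam0_cvg j) _ (lt1 j)).
have F : \forall n \near \oo, False.
  near=> n; have l0 : 0 < ls n by near: n; exact: ls_cvg.
  have rhon : forall j, lam n j / ls n < 1 by near: n.
  have : ls n < ls n.
    apply/bigmax_ltP; split=> // j _.
    by rewrite -[ltRHS]mul1r -ltr_pdivrMr.
  by rewrite ltxx.
have [n _ /(_ n (leqnn n))] := F; exact.
Unshelve. all: by end_near. Qed.

(** One bad [beta] for each large [n] suffices to make the infimum small. At this [beta], coverage
    entails that the noise is large. *)
Lemma cover_upper (dd e : R) : 0 < dd < 1 -> 0 < e ->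
  \forall n \near \oo, exists beta,
  (P (cover_event (X n) (lam n) (eps n) beta (scale n)
        (Mset C (fun j => dd * lam0 j)%R psi)) <= e%:E)%E.
Proof.
move=> dd01 e0; have [k k0 reg] := regular_near.
have [j0 j01] := lam0_eq1_exists.
pose B := Num.sqrt (p%:R / k); have B0 : 0 <= B by exact: sqrtr_ge0.
have [L L0 pert] := mulmx_qform_perturb C B0.
have [al al0 Cal] := mx_entries_bounded (invmx C).
(* Constant of the estimate [va] below: [al] bounds the entries of [invmx C], and
   [t * (1 + p%:R * B)] those of [q]. *)
pose L2 := p%:R * (al * (1 + p%:R * B)).
have pB0 : 0 <= p%:R * B by rewrite mulr_ge0.
have L20 : 0 <= L2 by rewrite !mulr_ge0 // ?(ltW al0) // addr_ge0.
have Cu : C \in unitmx.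
  by have [kC kC0 hC] := qform_lower_bound C_pd; exact: qform_unitmx kC0 hC.
have [l [t [l0 /andP[t0 t1] tl key]]] :=
  kkt_above_boundary (invmx_diag_gt0 j0 C_pd) dd01 (ltW L0) L20.
have rhos : \forall n \near \oo, 1 - t < lam n j0 / ls n.
  by apply: (cvgr_gt _ (@lam0_cvg j0)); rewrite j01 ltrBlDr ltrDl.
near=> n.
have rn : regular k n by near: n.
have [n0 ls0 Dk] := rn.
have sl0 : 0 < Num.sqrt (ls n) by rewrite sqrtr_gt0.
have nR0 : 0 < n%:R :> R by rewrite ltr0n.
(* Keeps the rescaled coordinates other than [j0] at [n%:R - t >= t^-1] or more, so that their
   gradient entries are at most [t]. *)
have n_large : t^-1 + 1 <= n%:R.
  by apply: ltW; near: n; exact: nbhs_infty_gtr.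
have [mE PE] : measurable [set w | exists j,
      t * Num.sqrt (ls n) < `|W n w j 0|] /\
    (P [set w | exists j, t * Num.sqrt (ls n) < `|W n w j 0|]%R <= e%:E)%E.
  by near: n; exact: W_large_prob.
have Dn i j : `|D n i j - C i j| <= t.
  by apply: ltW; move: i j; near: n; exact: cvg_mx_coord_near.
have rho1 : 1 - t <= lam n j0 / ls n by apply: ltW; near: n.
have rho_le1 j : lam n j / ls n <= 1.
  by rewrite ler_pdivrMr // mul1r lam_le_lamstar.
(* After rescaling, coordinate [j0] is the value [l] supplied by [kkt_above_boundary], and the
   others grow like [n%:R], which makes their penalties negligible. *)
pose beta : 'cV[R]_p := scale n *: \col_j (if j == j0 then l else n%:R).
exists beta; apply: le_trans PE; apply: le_measure; rewrite ?inE //.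
  apply: (cover_event_closed_measurable k0 rn); exact: Mset_closed.
move=> w; rewrite (cover_eventE rn) => -[b hb].
rewrite (rescaled_deviation k0 rn _ _ w).
apply: contraPP => nE Mb.
have W1 j : `|(Num.sqrt (ls n))^-1 * W n w j 0| <= t.
  rewrite normrM normfV (gtr0_norm sl0) ler_pdivrMl // mulrC leNgt.
  by apply/negP => h; apply: nE; exists j.
pose y := X n *m beta + epsvec (eps n) w.
pose ell j := Num.sqrt (n%:R / ls n) * LSest (X n) y j 0.
have ellE j : ell j = (if j == j0 then l else n%:R) +
    (Num.sqrt (ls n))^-1 * W n w j 0.
  rewrite /ell (rescaled_LSest k0 rn); congr (_ + _).
  by rewrite !mxE mulrA mulVf ?mul1r // gt_eqF // (scale_gt0 rn).
have ell_j0 : `|ell j0 - l| <= t by rewrite ellE eqxx addrAC subrr add0r.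
have ell_other j : j != j0 -> t^-1 <= `|ell j|.
  move=> /negbTE jj0; rewrite ellE jj0; have /ler_normlP[h _] := W1 j.
  by apply: le_trans (ler_norm _); lra.
have ell_neq0 j : ell j != 0.
  rewrite -normr_gt0; have [->|jj0] := eqVneq j j0.
    by have /ler_normlP[h _] := ell_j0; apply: lt_le_trans (ler_norm _); lra.
  by apply: lt_le_trans (ell_other j jj0); rewrite invr_gt0.
have LS0 j : LSest (X n) y j 0 != 0.
  by apply: contraNN (ell_neq0 j) => /eqP h; rewrite /ell h mulr0.
have Gu := gram_unit k0 rn.
have vB := scaled_kkt_bounded (lam_ge0 n) Gu ls0 n0 hb k0 Dk
  (lam_le_lamstar n) LS0.
have kb := scaled_kkt_bound (lam_ge0 n) Gu ls0 n0 hb.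
have ks := scaled_kkt_sign (lam_ge0 n) Gu ls0 n0 hb (LS0 j0).
move: Mb vB kb ks; rewrite -/y; move: (_ *: (b - _)) => v Mb vB kb ks.
set z := _ *: W n w in Mb.
have zt j : `|z j 0| <= t by rewrite mxE.
have pe := pert (D n) v z t _ Dn vB zt.
have {}pe j := pe (introT andP (conj (ltW t0) t1)) j.
have g_other j : j != j0 -> `|(D n *m v) j 0| <= t.
  move=> jj0; have := le_trans (kb j) (rho_le1 j).
  have := ell_other j jj0; rewrite -/(ell j) => h1 h2.
  rewrite -[leRHS]mul1r -ler_pdivrMr //; apply: le_trans h2.
  by rewrite ler_wpM2l.
(* The gradient [D n *m v] is nearly a multiple of the unit vector at [j0]; applying [invmx C] makes
   [v j0 0] nearly [invmx C j0 j0] times its entry there. *)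
have va : `|v j0 0 - invmx C j0 j0 * (D n *m v) j0 0| <= L2 * t.
  pose q := C *m v - (D n *m v) j0 0 *: delta_mx j0 (0 : 'I_1).
  have -> : v j0 0 - invmx C j0 j0 * (D n *m v) j0 0 = (invmx C *m q) j0 0.
    have col_j0 : (invmx C *m delta_mx j0 (0 : 'I_1)) j0 0 = invmx C j0 j0.
      rewrite mxE (bigD1 j0) //= big1 ?addr0 ?mxE ?eqxx ?mulr1 //.
      by move=> i /negbTE ij; rewrite mxE ij mulr0.
    rewrite /q mulmxBr mulKmx // -scalemxAr -col_j0.
    by move: (_ *m delta_mx _ _) ((D n *m v) j0 0) => x g; rewrite !mxE mulrC.
  have qb j : `|q j 0| <= t * (1 + p%:R * B).
    have e1 := mulmx_perturb j Dn vB; rewrite distrC in e1.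
    have -> : q j 0 = ((C *m v) j 0 - (D n *m v) j 0) +
        ((D n *m v) j 0 - (D n *m v) j0 0 * (j == j0)%:R).
      by rewrite /q !mxE eqxx andbT; ring.
    rewrite (le_trans (ler_normD _ _)) // mulrDr mulr1 addrC lerD //; last first.
      by rewrite [t * _]mulrCA.
    have [->|jj0] := eqVneq j j0; first by rewrite mulr1 subrr normr0 ltW.
    by rewrite mulr0 subr0 g_other.
  apply: le_trans (mulmx_coord_bound j0 Cal qb) _.
  by rewrite le_eqVlt /L2; apply/orP; left; apply/eqP; ring.
have rho01 : 1 - t <= lam n j0 / ls n <= 1 by rewrite rho1 rho_le1.
have := key (ell j0) _ _ _ ell_j0 rho01 (kb j0) ks va.
have [_ /ler_normlP[p2 _]] := pe j0.
have dd0 : 0 < dd by case/andP: dd01.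
(* By [key] and [p2], the product at [j0] for [v + z] and [C] exceeds [dd]. This contradicts [Mset]
   whether it imposes the equation or the inequality at [j0]. *)
have [M1 M2] := Mb j0; have [pinf|pfin] := eqVneq (psi j0) +oo%E.
  by move: p2; rewrite (M1 pinf) mulr0; lra.
have : (psi j0 < +oo)%E by rewrite ltey.
by move=> /M2; rewrite j01 mulr1; lra.
Unshelve. all: by end_near. Qed.

End adaptive_lasso.

(** * From the limit law to the two coverage limits *)

Unset Implicit Arguments.

Theorem theorem4 (R : realType) (d : measure_display) (T : measurableType d)
  (P : probability T R) (p : nat)
  (X : forall n : nat, 'M[R]_(n, p))
  (eps : forall n : nat, 'I_n -> T -> R) (sigma : R)
  (C : 'M[R]_p)
  (lam : nat -> 'I_p -> R) (lam0 : 'I_p -> R) (psi : 'I_p -> \bar R) :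
  (* design: full column rank, X'X/n -> C positive definite *)
  (forall n : nat, (p <= n)%N -> \rank (X n) = p) ->
  C^T = C ->
  (forall v : 'cV[R]_p, v != 0 -> 0 < (v^T *m C *m v) 0 0) ->
  (fun n : nat => n%:R^-1 *: ((X n)^T *m X n)) @ \oo --> C ->
  (* errors: i.i.d. components, mean zero, variance sigma^2 > 0 *)
  0 < sigma ->
  (forall n : nat, iid_family P (eps n)) ->
  (forall (n : nat) (i : 'I_n),
     P.-integrable setT (fun w => (eps n i w)%:E) /\
     (\int[P]_w (eps n i w)%:E = 0)%E /\
     (\int[P]_w ((eps n i w) ^+ 2)%:E = (sigma ^+ 2)%:E)%E) ->
  (* sqrt(n)(X'X)^{-1}X'eps -> N(0, sigma^2 C^{-1}) in distribution,
     expressed through characteristic functions (Levy continuity) *)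
  (forall t : 'cV[R]_p,
     (fun n : nat => (\int[P]_w
        (cos ((t^T *m (Num.sqrt n%:R *: LSest (X n) (epsvec (eps n) w))) 0 0))%:E)%E)
       @ \oo --> (expR (- (sigma ^+ 2 / 2) * (t^T *m invmx C *m t) 0 0))%:E /\
     (fun n : nat => (\int[P]_w
        (sin ((t^T *m (Num.sqrt n%:R *: LSest (X n) (epsvec (eps n) w))) 0 0))%:E)%E)
       @ \oo --> 0%E) ->
  (* the events {betaLS_j = 0} have probability zero *)
  (forall (n : nat), (p <= n)%N -> forall (beta : 'cV[R]_p) (j : 'I_p),
     P [set w | LSest (X n) (X n *m beta + epsvec (eps n) w) j 0 = 0] = 0%E) ->
  (* tuning parameters *)
  (forall n j, 0 <= lam n j) ->
  (forall j, (\forall n \near \oo, 0 < lam n j) \/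
             (\forall n \near \oo, lam n j = 0)) ->
  (fun n : nat => lamstar (lam n) / n%:R) @ \oo --> 0 ->
  (forall M : R, \forall n \near \oo, M < lamstar (lam n)) ->
  (forall j, 0 <= lam0 j <= 1) ->
  (forall j, (fun n : nat => lam n j / lamstar (lam n)) @ \oo --> lam0 j) ->
  (forall j, (fun n : nat => psi_ratio (lam n) j) @ \oo --> psi j) ->
  (forall O : set 'cV[R]_p, @open 'cV[R]_p O -> Mset C lam0 psi `<=` O ->
     (fun n : nat => inf_cover P (X n) (lam n) (eps n)
        (Num.sqrt (lamstar (lam n) / n%:R)) O) @ \oo --> 1%E)
  /\
  (forall dd : R, 0 < dd < 1 ->
     (fun n : nat => inf_cover P (X n) (lam n) (eps n)
        (Num.sqrt (lamstar (lam n) / n%:R)) (Mset C (fun j => dd * lam0 j) psi))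
       @ \oo --> 0%E).
Proof.
move=> _ _ Cpd Dcvg s0 iid _ clt _ lam0_ _ _ lsy lam01 rho psi_.
have mW n j : measurable_fun setT
    (fun w => (Num.sqrt n%:R *: LSest (X n) (epsvec (eps n) w)) j 0).
  by apply: W_coord_measurable => m i; have [] := iid m.
(* [expR (- (tau j * s ^+ 2))] is the characteristic function of the [j]-th marginal of the limit
   law, obtained from the joint one at [s *: delta_mx j 0]. *)
pose tau j := sigma ^+ 2 / 2 * invmx C j j.
have tau0 j : 0 < tau j.
  by rewrite mulr_gt0 ?divr_gt0 ?exprn_gt0 // invmx_diag_gt0.
have deltaE (s : R) j (v : 'cV[R]_p) :
    ((s *: delta_mx j (0 : 'I_1))^T *m v) 0 0 = s * v j 0.
  rewrite mxE (bigD1 j) //= big1 ?addr0 => [|i /negbTE ij].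
    by rewrite !mxE !eqxx mulr1.
  by rewrite !mxE ij mulr0 mul0r.
have qE (s : R) j : - (sigma ^+ 2 / 2) *
    ((s *: delta_mx j (0 : 'I_1))^T *m invmx C *m
     (s *: delta_mx j (0 : 'I_1))) 0 0 =
    - (tau j * s ^+ 2).
  rewrite -mulmxA deltaE -scalemxAr mxE.
  rewrite [(invmx C *m _) j 0]mxE (bigD1 j) //= big1 ?addr0 => [|i /negbTE ij].
    by rewrite !mxE !eqxx /tau /=; ring.
  by rewrite mxE ij mulr0.
have tight j e : 0 < e -> exists2 K : R, 0 < K & \forall n \near \oo,
    (P [set w | K < `|(Num.sqrt n%:R *: LSest (X n) (epsvec (eps n) w)) j 0|]%R
       <= e%:E)%E.
  apply: (tightness (fun n => mW n j) (tau := tau j)); last exact: ltW.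
  move=> s; have [h _] := clt (s *: delta_mx j (0 : 'I_1)); move: h; rewrite qE.
  by under eq_fun do under eq_integral do rewrite deltaE.
have anti j e : 0 < e -> exists2 eta : R, 0 < eta & \forall n \near \oo,
    forall a : R, (P [set w |
      `|a + (Num.sqrt n%:R *: LSest (X n) (epsvec (eps n) w)) j 0| < eta]%R
       <= e%:E)%E.
  apply: (anticoncentration (fun n => mW n j) (tau := tau j)) => // s.
    have [h _] := clt (s *: delta_mx j (0 : 'I_1)); move: h; rewrite qE.
    by under eq_fun do under eq_integral do rewrite deltaE.
  have [_ h] := clt (s *: delta_mx j (0 : 'I_1)); move: h.
  by under eq_fun do under eq_integral do rewrite deltaE.
have eps_meas n i : measurable_fun setT (eps n i) by have [] := iid n.
have [k k0 reg] := regular_near Dcvg Cpd lsy.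
split=> [S So MS|dd dd01]; apply: cvg_fin_near => e e0.
  have low := cover_lower lam0_ eps_meas Dcvg Cpd lsy tight anti rho psi_ So MS e0.
  near=> n.
  have rn : regular X lam k n by near: n.
  split.
    (* The threshold for [n] is common to all [beta], so the bound passes to the infimum. *)
    apply: le_ereal_inf_tmp => _ [beta _ <-]; move: beta; near: n; exact: low.
  apply: (@le_trans _ _ 1%E); last by rewrite lee_fin lerDl ltW.
  apply: le_trans (probability_le1 P
    (cover_event_open_measurable lam0_ eps_meas k0 rn 0 So)).
  by apply: ereal_inf_lbound; exists 0.
have lam0_le1 j : lam0 j <= 1 by case/andP: (lam01 j).
have upp := cover_upper lam0_ eps_meas Dcvg Cpd lsy tight psi rho lam0_le1 dd01 e0.
near=> n; split.
  apply: le_ereal_inf_tmp => _ [beta _ <-].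
  by apply: (@le_trans _ _ 0%E); [rewrite lee_fin sub0r oppr_le0 ltW|].
have [beta hb] : exists beta, (P (cover_event (X n) (lam n) (eps n) beta
    (Num.sqrt (lamstar (lam n) / n%:R))
    (Mset C (fun j => dd * lam0 j)%R psi)) <= e%:E)%E by near: n.
rewrite add0r; apply: le_trans hb; apply: ereal_inf_lbound; by exists beta.
Unshelve. all: by end_near. Qed.
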